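(* Let $\rho$ be a geometrically infinitely divisible probability measure on $[0,\infty)$ with $\rho(\{0\})=0$, let $\mu$ be a locally finite measure on $[0,\infty)$, and let $\xi\sim F(\mu,\rho)$ be a Feller random measure with parameters $\mu$ and $\rho$. Then $\xi$ is almost surely atom-free, i.e., almost surely, $\xi(\{t\})=0$ for all $t\ge0$.
   Context: A measure on $[0,\infty)$ is locally finite if it is finite on bounded sets. $(f*\kappa)(t)=\int_{[0,t]}f(t-s)\,\kappa(ds)$. A probability measure $\rho$ on $[0,\infty)$ is geometrically infinitely divisible (GID) iff its Laplace transform is $\hat\rho(\lambda)=1/(1-\log\hat\nu(\lambda))$ for some infinitely divisible probability measure $\nu$ on $[0,\infty)$. Feller random measure: for a locally finite $\mu$ and a GID $\rho$ with $\rho(\{0\})=0$, $F(\mu,\rho)$ is the law of the locally finite random measure $\xi$ on $[0,\infty)$ uniquely characterized by $\mathbb{E}[e^{(f*\xi)(t)}]=e^{(h[f]*\mu)(t)}$, $t\ge0$, for all continuous $f:[0,\infty)\to\mathbb{R}$ with $f(0)=0$ and $|f|\le1/2$, where $h[f]$ is the unique locally bounded solution of $h=(f+\frac12h^2)*\rho$. (Existence and uniqueness of this law may be taken as known.) *)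

(* Defs.v *)
From HB Require Import structures.
From mathcomp Require Import all_boot all_order all_algebra.
From mathcomp Require Import all_classical all_reals all_analysis.

Set Implicit Arguments.
Unset Strict Implicit.
Unset Printing Implicit Defensive.

Import Order.TTheory GRing.Theory Num.Theory.
Import numFieldNormedType.Exports.

Local Open Scope classical_set_scope.
Local Open Scope ring_scope.

(* A measure on [0, +oo) is represented by a Borel measure on R that gives no
   mass to the negative reals. *)
Definition on_half_line (R : realType)
    (m : set (measurableTypeR R) -> \bar R) : Prop :=
  m [set x : R | x < 0] = 0%E.

Definition locally_finite (R : realType)
    (m : set (measurableTypeR R) -> \bar R) : Prop :=
  forall A : set (measurableTypeR R), measurable A ->
    bounded_set (A : set R) -> (m A < +oo)%E.

Definition conv_fun (R : realType) (f : R -> R)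
    (kappa : {measure set (measurableTypeR R) -> \bar R}) (t : R) : R :=
  \int[kappa]_(s in `[0, t]) f (t - s).

Definition laplace (R : realType)
    (m : {measure set (measurableTypeR R) -> \bar R}) (lambda : R) : R :=
  \int[m]_(x in `[0, +oo[) expR (- (lambda * x)).

Definition conv_measure (R : realType)
    (m1 m2 : set (measurableTypeR R) -> \bar R) :
    set (measurableTypeR R) -> \bar R :=
  pushforward (m1 \x m2)%E
    (fun p : measurableTypeR R * measurableTypeR R =>
       (p.1 + p.2 : measurableTypeR R)).

Fixpoint conv_power (R : realType) (m : set (measurableTypeR R) -> \bar R)
    (n : nat) : set (measurableTypeR R) -> \bar R :=
  if n is k.+1 then conv_measure (conv_power m k) m
  else dirac (0 : measurableTypeR R).

Definition infinitely_divisible (R : realType)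
    (nu : probability (measurableTypeR R) R) : Prop :=
  forall n : nat, (0 < n)%N ->
    exists nun : probability (measurableTypeR R) R, on_half_line nun /\
      forall A : set (measurableTypeR R), measurable A ->
        nu A = conv_power nun n A.

(* Geometrically infinitely divisible, characterized by the Laplace transform. *)
Definition GID (R : realType)
    (rho : probability (measurableTypeR R) R) : Prop :=
  on_half_line rho /\
  exists nu : probability (measurableTypeR R) R,
    [/\ on_half_line nu, infinitely_divisible nu &
        forall lambda : R, 0 <= lambda ->
          laplace rho lambda = (1 - ln (laplace nu lambda))^-1].

(* Functions on [0, +oo) are total functions on R of which only the values on
   [0, +oo) matter. *)
Definition test_function (R : realType) (f : R -> R) : Prop :=
  [/\ {within `[0, +oo[, continuous f}, f 0 = 0 &
      forall t : R, 0 <= t -> `|f t| <= 2^-1].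

Definition locally_bounded (R : realType) (h : R -> R) : Prop :=
  forall T : R, exists M : R, forall t : R, 0 <= t <= T -> `|h t| <= M.

(* Borel measurability is implicit in the integral equation; without it the
   integral would be a junk value. *)
Definition riccati_solution (R : realType)
    (rho : {measure set (measurableTypeR R) -> \bar R}) (f h : R -> R) : Prop :=
  [/\ measurable_fun (`[0, +oo[ : set (measurableTypeR R))
        (h : measurableTypeR R -> measurableTypeR R),
      locally_bounded h &
      forall t : R, 0 <= t ->
        h t = conv_fun (fun s => f s + 2^-1 * h s ^+ 2) rho t].

(* xi has law F(mu, rho). A kernel from the sample space to R is a random
   measure: for each Borel set A, the map w |-> xi w A is measurable. The function h[f] is unique only up
   to its values on (-oo, 0), so the identity is asked for every h solving the
   equation; those values are not used by conv_fun. *)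
Definition Feller_random_measure (R : realType) (d : measure_display)
    (Omega : measurableType d) (P : probability Omega R)
    (mu : {measure set (measurableTypeR R) -> \bar R})
    (rho : probability (measurableTypeR R) R)
    (xi : R.-ker Omega ~> measurableTypeR R) : Prop :=
  (forall w : Omega, on_half_line (xi w) /\ locally_finite (xi w)) /\
  forall f h : R -> R, test_function f -> riccati_solution rho f h ->
    forall t : R, 0 <= t ->
      ('E_P[fun w => expR (conv_fun f (xi w) t)] =
        (expR (conv_fun h mu t))%:E)%E.

(* Main.v *)
Require Import Defs.
From HB Require Import structures.
From mathcomp Require Import all_boot all_order all_algebra.
From mathcomp Require Import all_classical all_reals all_analysis.
From mathcomp Require Import measurable_realfun ring lra.

Import Order.TTheory GRing.Theory Num.Theory.
Import numFieldNormedType.Exports.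
Local Open Scope classical_set_scope.
Local Open Scope ring_scope.

Set Implicit Arguments.
Unset Strict Implicit.
Unset Printing Implicit Defensive.

(** Write [phi] for minus the logarithm of the Laplace transform of [nu], so
    that [rho] has transform [1 / (1 + phi)]: it is the potential measure,
    killed at rate 1, of the subordinator with Laplace exponent [phi]. The
    condition [rho {0} = 0] says that this subordinator is not compound
    Poisson, and such a potential measure has no atom at all ([GID_atomless]).
    Once this is known the statement is a second moment estimate.

    Expanding the characterization of the law to second order in the test
    function, [X = (f * xi)(t)] has mean [(g * mu)(t)] and variance
    [(g^2 * rho * mu)(t)], with [g = f * rho]; [second_moment_le] is the upper
    bound, up to a constant factor. Let [f] run through windows of width of
    order [1/n] that cover the time interval with bounded overlap. The sum of
    the corresponding functions [g] is bounded, and each of them is at most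
    some [eta] that tends to 0 as [n] grows, because an atomless probability is
    uniformly small on short intervals ([small_intervals]). Hence the second
    moments add up to a multiple of [eta] ([sum_moment_bound_le]). On the other
    hand an atom of mass [c] makes one of the variables [X] at least [c], so by
    Markov's inequality the event that such an atom exists is contained in
    events of arbitrarily small probability ([large_atoms_le]).

    Why [rho] has no atom. The integral of [q (exp (- x))] against a measure,
    for a polynomial [q], is a linear combination of values of the Laplace
    transform at integers, and [q = (1 - (u - exp (- x)) ^ 2) ^ K] with [K]
    large reads off the mass at [x]. Let [nun] be the [n]-th convolution root
    of [nu]. The transform of [rho - exp (- 1/n) (nun * rho)] is a limit of
    transforms of positive measures of mass at most [1/n], so that the mass of
    [rho] at [x] is at most [1/n] plus that of [nun * rho] ([expint_GID_le]).
    As [nun] does not charge 0 either ([root_no_atom0]), the latter is an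
    average of masses of [rho] at points strictly to the left of [x]. Therefore
    the atoms of [rho] that exceed a given level have no leftmost element,
    which is impossible since there are finitely many of them. *)

Local Notation mR := measurableTypeR.

(** * Integrals of bounded functions on the half-line *)

Section BoundedIntegrals.
Context {R : realType}.
Implicit Types (m : {measure set (mR R) -> \bar R}) (A : set (mR R)).

Lemma bounded_integrable m A (f : mR R -> R) (M : R) :
  measurable A -> (m A < +oo)%E -> measurable_fun setT f ->
  (forall x, A x -> `|f x| <= M) -> m.-integrable A (EFin \o f).
Proof.
move=> mA mAoo mf fM; apply: measurable_bounded_integrable => //.
- exact: measurable_funTS.
- exists M; split; first exact: num_real.
  by move=> x Mx y Ay; apply: (le_trans (fM y Ay)); apply: ltW.
Qed.

Lemma Rintegral_sum m A (I : Type) (s : seq I) (F : I -> mR R -> R) :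
  measurable A -> (forall i, m.-integrable A (EFin \o F i)) ->
  \int[m]_(x in A) (\sum_(i <- s) F i x) =
  \sum_(i <- s) \int[m]_(x in A) F i x.
Proof.
move=> mA iF; elim: s => [|i s IHs].
  rewrite big_nil; under eq_Rintegral do rewrite big_nil.
  by rewrite Rintegral_cst// mul0r.
rewrite big_cons; under eq_Rintegral do rewrite big_cons.
rewrite RintegralD// ?IHs//.
rewrite (_ : _ \o _ = fun x => \sum_(i <- s) (F i x)%:E)%E; last first.
  by apply/funext => x /=; rewrite sumEFin.
by apply: integrable_sum => // ? _; exact: iF.
Qed.

End BoundedIntegrals.

Section HalfLine.
Context {R : realType}.
Implicit Types (m : probability (mR R) R) (q : {poly R}).

Lemma half_line1 m : on_half_line m -> m `[0, +oo[%classic = 1%E.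
Proof.
move=> m0; rewrite -[LHS]adde0 -m0 -measureU//.
- rewrite -(@probability_setT _ _ _ m); congr (m _).
  apply/seteqP; split=> // x _ /=; rewrite in_itv /= andbT.
  by case: (leP 0 x) => ?; [left|right].
- rewrite (_ : [set x | x < 0] = `]-oo, 0[%classic)//.
- apply/seteqP; split => // x [] /=.
  by rewrite in_itv /= andbT => /le_lt_trans h /h; rewrite ltxx.
Qed.

(** The integral of [q (exp (- x))]: the linear functional that sends the
    monomial of degree [j] to the value at [j] of the Laplace transform. *)
Definition expint m q : R := \int[m]_(x in `[0, +oo[) q.[expR (- x)].

Lemma measurable_horner_expN q :
  measurable_fun [set: mR R] ((fun x => q.[expR (- x)]) : mR R -> R).
Proof.
rewrite (_ : (fun x => _) =
  (fun x => \sum_(i < size q) q`_i * expR (- x) ^+ i)); last first.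
  by apply/funext => x; rewrite horner_coef.
apply: measurable_sum => i; apply: measurable_funM => //.
apply: measurable_funX; apply: measurableT_comp => //.
Qed.

Lemma expN_itv (x : R) : 0 <= x -> 0 < expR (- x) <= 1.
Proof. by move=> x0; rewrite expR_gt0 /= -expR0 ler_expR oppr_le0. Qed.

Lemma half_line_integrable m (f : mR R -> R) (M : R) :
  on_half_line m -> measurable_fun setT f ->
  (forall x, 0 <= x -> `|f x| <= M) -> m.-integrable `[0, +oo[ (EFin \o f).
Proof.
move=> m0 mf fM; apply: (@bounded_integrable _ _ _ _ M) => //.
  by rewrite ltey_eq fin_num_measure.
by move=> x /=; rewrite in_itv /= andbT; exact: fM.
Qed.

Lemma expint_laplace m q : on_half_line m ->
  expint m q = \sum_(i < size q) q`_i * laplace m i%:R.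
Proof.
move=> m0; rewrite /expint.
under eq_Rintegral do rewrite horner_coef.
have iX i : m.-integrable `[0, +oo[ (EFin \o (fun x => expR (- x) ^+ i)).
  apply: (@half_line_integrable _ _ 1) => //.
    by apply: measurable_funX; apply: measurableT_comp => //.
  move=> x /expN_itv /andP[e0 e1].
  by rewrite normrX exprn_ile1 ?normr_ge0// ger0_norm// ltW.
rewrite Rintegral_sum//.
  apply: eq_bigr => i _; rewrite RintegralZl//; congr (_ * _).
  by apply: eq_Rintegral => x _; rewrite -expRM_natl mulrN.
move=> i; rewrite (_ : _ \o _ = fun x => (q`_i)%:E * (expR (- x) ^+ i)%:E)%E//.
by apply: (integrableZl _ _ (iX i)).
Qed.


(** Powers of a function with values in [0, 1] decrease to the indicator of
    the points where it equals 1; this is how an atom is read off from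
    integrals. *)
Lemma cvg_powers_atom m (b : mR R -> R) (x0 : R) :
  on_half_line m -> measurable_fun setT b ->
  (forall x, 0 <= x -> 0 <= b x <= 1) ->
  0 <= x0 -> (forall x, 0 <= x -> (b x == 1) = (x == x0)) ->
  \int[m]_(x in `[0, +oo[) b x ^+ K @[K --> \oo] --> fine (m [set x0]).
Proof.
move=> m0 mb b01 x00 b1.
have cvgE : (\int[m]_(x in `[0%R, +oo[) (b x ^+ K)%:E)%E @[K --> \oo] -->
    (\int[m]_(x in `[0%R, +oo[) (\1_[set x0] x)%:E)%E.
  apply: (@dominated_cvg _ _ _ m _ _ _ _ (fun=> 1%E)) => //.
  - move=> K; apply/measurable_EFinP/measurable_funTS.
    exact: measurable_funX.
  - move=> x /=; rewrite in_itv /= andbT => x_ge0; apply: cvg_EFin.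
      by near=> K.
    rewrite indicE in_set1 /= -(b1 _ x_ge0).
    have [b0 ble1] := andP (b01 _ x_ge0).
    have [bx|bn1] := eqVneq (b x) 1.
      rewrite (_ : _ \o _ = fun=> 1); first exact: cvg_cst.
      by apply/funext => K /=; rewrite bx expr1n.
    by apply: cvg_expr; rewrite ger0_norm// lt_neqAle bn1.
  - apply: (@half_line_integrable _ (fun=> 1) 1) => //.
    by move=> *; rewrite normr1.
  - move=> K x /=; rewrite in_itv /= andbT => /b01/andP[b0 ble1].
    by rewrite lee_fin ger0_norm ?exprn_ge0 ?exprn_ile1.
apply: fine_cvg; rewrite fineK ?fin_num_measure//.
rewrite (_ : m [set x0] = (\int[m]_(x in `[0%R, +oo[) (\1_[set x0] x)%:E)%E)//.
rewrite integral_indic//; congr (m _).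
by apply/seteqP; split=> [x /= ->|x []//]; rewrite in_itv /= x00.
Unshelve. all: by end_near.
Qed.

End HalfLine.

(** * Convolution of probabilities and the Laplace transform *)

Section Convolution.
Context {R : realType}.

Lemma half_lineU :
  [set: mR R] = `]-oo, 0[%classic `|` `[0, +oo[%classic.
Proof.
apply/seteqP; split=> // x _ /=; rewrite !in_itv /= andbT.
by case: (leP 0 x) => ?; [right|left].
Qed.

Lemma ge0_integral_half_line (m : {measure set (mR R) -> \bar R})
    (f : mR R -> \bar R) :
  on_half_line m -> measurable_fun setT f -> (forall x, 0 <= f x)%E ->
  (\int[m]_x f x = \int[m]_(x in `[0%R, +oo[) f x)%E.
Proof.
move=> m0 mf f0; rewrite half_lineU ge0_integral_setU//.
- rewrite null_set_integral ?add0e//; first exact: measurable_funTS.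
- exact: measurable_funTS.
- apply/eqP/seteqP; split => // x /= []; rewrite !in_itv /= andbT.
  by move=> /lt_le_trans h /h; rewrite ltxx.
Qed.

Lemma laplaceE (m : probability (mR R) R) (l : R) :
  on_half_line m -> 0 <= l ->
  (laplace m l)%:E = (\int[m]_x (expR (- (l * x)))%:E)%E.
Proof.
move=> m0 l0; have mE : measurable_fun [set: mR R]
    ((fun x => expR (- (l * x))) : mR R -> R).
  apply: measurableT_comp => //; apply: measurableT_comp => //.
rewrite ge0_integral_half_line//; last exact/measurable_EFinP.
rewrite fineK//; apply: integrable_fin_num => //.
apply: (@half_line_integrable _ _ (fun x => expR (- (l * x))) 1) => // x x0.
by rewrite ger0_norm ?expR_ge0// -expR0 ler_expR oppr_le0 mulr_ge0.
Qed.

Lemma measurable_add :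
  measurable_fun [set: mR R * mR R] (fun p => p.1 + p.2 : mR R).
Proof.
by apply: measurable_funD; [exact: measurable_fst|exact: measurable_snd].
Qed.

(** [conv_measure], a mere set function, bundled as a probability. *)
Definition conv_prob (m1 m2 : probability (mR R) R) : probability (mR R) R :=
  distribution (m1 \x m2)%E (mfun_Sub (mem_set measurable_add)).

Lemma conv_probE (m1 m2 : probability (mR R) R) :
  conv_measure m1 m2 = conv_prob m1 m2.
Proof. by []. Qed.

Lemma conv_prob_half_line (m1 m2 : probability (mR R) R) :
  on_half_line m1 -> on_half_line m2 -> on_half_line (conv_prob m1 m2).
Proof.
move=> m10 m20; apply/eqP; rewrite eq_le measure_ge0 andbT.
have mneg : measurable ([set x | x < 0] : set (mR R)).
  by rewrite (_ : [set x | x < 0] = `]-oo, 0[%classic).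
have P1 : ((m1 \x m2) ([set x | (x < 0)%R] `*` setT) = 0)%E.
  by rewrite [LHS]product_measure1E// [X in (X * _)%E]m10 mul0e.
have P2 : ((m1 \x m2) (setT `*` [set x | (x < 0)%R]) = 0)%E.
  by rewrite [LHS]product_measure1E// [X in (_ * X)%E]m20 mule0.
have : ((m1 \x m2) ([set x | (x < 0)%R] `*` setT `|`
                    setT `*` [set x | (x < 0)%R]) <=
  (m1 \x m2) ([set x | (x < 0)%R] `*` setT) +
  (m1 \x m2) (setT `*` [set x | (x < 0)%R]))%E.
  by apply: measureU2; exact: measurableX.
rewrite P1 P2 adde0; apply: le_trans.
apply: (@le_measure _ _ _ (m1 \x m2)%E).
- by rewrite inE -[X in measurable X]setTI; exact: measurable_add.
- rewrite inE; apply: measurableU; exact: measurableX.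
- move=> [x y] /= xy; case: (ltP x 0) => x0; [by left|right; split => //=].
  by rewrite -(ltrD2l x) addr0 (lt_le_trans xy).
Qed.

Lemma laplace_conv (m1 m2 : probability (mR R) R) (l : R) :
  on_half_line m1 -> on_half_line m2 -> 0 <= l ->
  laplace (conv_prob m1 m2) l = laplace m1 l * laplace m2 l.
Proof.
move=> m10 m20 l0; apply: EFin_inj.
rewrite laplaceE//; last exact: conv_prob_half_line.
have mE : measurable_fun [set: mR R]
    ((fun x => expR (- (l * x))) : mR R -> R).
  apply: measurableT_comp => //; apply: measurableT_comp => //.
rewrite ge0_integral_distribution//; last first.
  exact/measurable_EFinP.
rewrite fubini_tonelli1//; last 2 first.
- by apply: measurableT_comp; [exact/measurable_EFinP|exact: measurable_add].
- by move=> x; rewrite lee_fin expR_ge0.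
rewrite /fubini_F EFinM !laplaceE// muleC -ge0_integralZl//; last 2 first.
- exact/measurable_EFinP.
- by apply: integral_ge0 => x _; rewrite lee_fin expR_ge0.
apply: eq_integral => x _ /=; rewrite muleC -ge0_integralZl//; last first.
  exact/measurable_EFinP.
by apply: eq_integral => y _ /=; rewrite -EFinM -expRD mulrDr opprD.
Qed.

Lemma dirac0_half_line : on_half_line (dirac (0 : mR R)).
Proof. by rewrite /on_half_line diracE memNset //= ltxx. Qed.

(** Convolution powers are probabilities, and the Laplace transform turns them
    into powers. *)
Lemma conv_power_prob (m : probability (mR R) R) (n : nat) : on_half_line m ->
  exists c : probability (mR R) R,
    [/\ conv_power m n = c, on_half_line c &
        forall l, 0 <= l -> laplace c l = laplace m l ^+ n].
Proof.
move=> m0; elim: n => [|n [c [cE c0 cl]]].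
  exists (dirac (0 : mR R)); split => //; first exact: dirac0_half_line.
  move=> l l0; apply: EFin_inj; rewrite laplaceE//; last exact: dirac0_half_line.
  rewrite integral_dirac//; last first.
    apply/measurable_EFinP; apply: measurableT_comp => //.
    by apply: measurableT_comp => //.
  by rewrite diracT mul1e mulr0 oppr0 expR0 expr0.
exists (conv_prob c m); split => /=.
- by rewrite cE conv_probE.
- exact: conv_prob_half_line.
- by move=> l l0; rewrite laplace_conv// cl// exprSr.
Qed.

(** The mass of [m1 * m2] at [x] averages the atoms of [m2] to the left of [x]
    when [m1] does not charge 0. *)
Lemma conv_prob_atom_le (m1 m2 : probability (mR R) R) (x c : R) :
  on_half_line m1 -> m1 [set 0] = 0%E -> 0 <= c ->
  (forall z, z < x -> (m2 [set z] <= c%:E)%E) ->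
  (conv_prob m1 m2 [set x] <= c%:E)%E.
Proof.
move=> m10 m1z c0 m2c.
have mpos : measurable (`]0, +oo[%classic : set (mR R)) by [].
rewrite /conv_prob /distribution /pushforward /= /product_measure1.
set A := (X in xsection X); have mA : measurable A.
  rewrite -[A]setTI; apply: measurable_add => //.
rewrite ge0_integral_half_line//; last exact: measurable_fun_xsection.
have -> : `[0%R, +oo[%classic = [set 0%R] `|` `]0%R, +oo[%classic :> set (mR R).
  by rewrite setU1itv.
rewrite ge0_integral_setU//; last 2 first.
- exact: measurable_funTS (measurable_fun_xsection _ mA).
- apply/eqP/seteqP; split => // y /= [->]; rewrite in_itv /= ltxx//.
rewrite null_set_integral//; last first.
  exact: measurable_funTS (measurable_fun_xsection _ mA).
rewrite add0e.
apply: (@le_trans _ _ (\int[m1]_(y in `]0%R, +oo[) (cst c%:E y)))%E.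
  apply: ge0_le_integral => //.
  - exact: measurable_funTS (measurable_fun_xsection _ mA).
  - move=> y /=; rewrite in_itv /= andbT => y0.
    rewrite (_ : xsection A y = [set x - y]).
      by apply: m2c; rewrite ltrBlDr ltrDl.
    apply/seteqP; split => z; rewrite /xsection /= inE /A /=.
      by move=> <-; rewrite addrC addKr.
    by move=> ->; rewrite addrC subrK.
rewrite integral_cst// -[leRHS]mule1; apply: lee_wpmul2l => //.
exact: probability_le1.
Qed.

End Convolution.

(** * Atoms of geometrically infinitely divisible laws *)

Section GIDAtoms.
Context {R : realType}.
Implicit Types (m : probability (mR R) R) (q : {poly R}).

Lemma ler_add_div_nat (a b C : R) :
  (forall N : nat, a <= b + C / N.+1%:R) -> a <= b.
Proof.
move=> H; rewrite leNgt; apply/negP => ba.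
have ab0 : 0 < a - b by rewrite subr_gt0.
have C0 : 0 <= `|C| by [].
have C1 : 0 < 1 + `|C| by lra.
have /ltr_add_invr[N] : 0 < (a - b) / (1 + `|C|) by rewrite divr_gt0.
rewrite add0r ltr_pdivlMr// => hN.
have N0 : 0 < N.+1%:R^-1 :> R by rewrite invr_gt0.
have : C / N.+1%:R <= N.+1%:R^-1 * `|C|.
  by rewrite mulrC ler_pM2l// ler_norm.
move: (H N) hN N0; set v := _^-1; nra.
Qed.

Lemma cvgn_ge (u : nat -> R) (l a : R) :
  u @ \oo --> l -> (forall n, a <= u n) -> a <= l.
Proof.
move=> ul au; apply: (ler_cvg_to (cvg_cst a) ul).
by near=> n; exact: au.
Unshelve. all: by end_near.
Qed.

Lemma le_expint m q1 q2 : on_half_line m ->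
  (forall u, 0 < u <= 1 -> q1.[u] <= q2.[u]) -> expint m q1 <= expint m q2.
Proof.
move=> m0 q12.
have ip q : m.-integrable `[0, +oo[ (EFin \o (fun x : mR R => q.[expR (- x)])).
  apply: (@half_line_integrable _ _ _ (\sum_(i < size q) `|q`_i|)) => //.
    exact: measurable_horner_expN.
  move=> x /expN_itv /andP[e0 e1]; rewrite horner_coef.
  apply: (le_trans (ler_norm_sum _ _ _)); apply: ler_sum => i _.
  rewrite normrM ler_piMr// normrX exprn_ile1 ?normr_ge0// ger0_norm// ltW.
apply: le_Rintegral => // x; rewrite /= in_itv /= andbT => x0.
by apply: q12; exact: expN_itv.
Qed.

Lemma expintC m (c : R) : on_half_line m -> expint m c%:P = c.
Proof.
move=> m0; rewrite /expint; under eq_Rintegral do rewrite hornerC.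
by rewrite Rintegral_cst// [X in fine X]half_line1// mulr1.
Qed.

Lemma expintXn m (j : nat) : on_half_line m ->
  expint m 'X^j = laplace m j%:R.
Proof.
move=> m0; apply: eq_Rintegral => x _.
by rewrite hornerXn -expRM_natl mulrN.
Qed.

Lemma laplace_le1 m (j : nat) : on_half_line m -> laplace m j%:R <= 1.
Proof.
move=> m0; rewrite -expintXn// -(expintC 1 m0); apply: le_expint => // u.
by move=> /andP[u0 u1]; rewrite hornerXn hornerC exprn_ile1// ltW.
Qed.

Lemma laplace_gt0 m (j : nat) : on_half_line m -> 0 < laplace m j%:R.
Proof.
move=> m0; rewrite lt_neqAle; apply/andP; split; last first.
  by apply: Rintegral_ge0 => x _; exact: expR_ge0.
apply/negP => /eqP l0.
have mE : measurable_fun (`[0, +oo[ : set (mR R))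
    ((fun x => (expR (- (j%:R * x)))%:E) : mR R -> \bar R).
  apply/measurable_EFinP/measurable_funTS.
  by apply: measurableT_comp => //; apply: measurableT_comp.
have := ae_eq_integral_abs m (measurable_itv `[0, +oo[) mE.
case=> /(_ _) ae _; have /ae : (\int[m]_(x in `[0%R, +oo[)
    `|(expR (- (j%:R * x)))%:E|)%E = 0%E.
  transitivity (laplace m j%:R)%:E; last by rewrite -l0.
  rewrite laplaceE// ge0_integral_half_line//.
    by apply: eq_integral => x _; rewrite gee0_abs// lee_fin expR_ge0.
  apply/measurable_EFinP.
  by apply: measurableT_comp => //; apply: measurableT_comp.
move=> [N [mN N0 subN]].
have : (m `[0%R, +oo[%classic <= m N)%E.
  apply: le_measure; rewrite ?inE// => x xI; apply: subN => /= /(_ xI).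
  by move=> [] /eqP; rewrite gt_eqF// expR_gt0.
by rewrite [X in (X <= _)%E]half_line1// N0 leNgt lte01.
Qed.

(** A left Riemann sum of [y |-> \int_0^(1/n) exp (- s y) ds], summed as a
    geometric progression; the error does not depend on [y]. *)
Lemma riemann_sum_expR (y : R) (n N : nat) : 0 < y -> (0 < n)%N -> (0 < N)%N ->
  `|(n * N)%:R^-1 * \sum_(j < N) expR (- (y / (n * N)%:R)) ^+ j -
    (1 - expR (- (y / n%:R))) / y| <= (n * N)%:R^-1.
Proof.
move=> y0 n0 N0; set K : R := (n * N)%:R; set r := expR _.
have K0 : 0 < K by rewrite ltr0n muln_gt0 n0.
set z := y / K; have z0 : 0 < z by rewrite divr_gt0.
have rE : expR (- (y / n%:R)) = r ^+ N.
  rewrite /r -expRM_natr mulNr -/z /z /K natrM; congr (expR (- _)).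
  by field; rewrite !pnatr_eq0 -!lt0n N0.
have r1 : 1 - r <= z by rewrite lerBlDr addrC -lerBlDr; have := expR_ge1Dx (- z).
have r0 : 0 < r by exact: expR_gt0.
have rz : z / (1 + z) <= 1 - r.
  rewrite (_ : z / (1 + z) = 1 - (1 + z)^-1); last by field; lra.
  rewrite lerB// /r -/z expRN lef_pV2 ?posrE ?expR_gt0 ?addr_gt0//.
  exact: expR_ge1Dx.
have r1_gt0 : 0 < 1 - r by apply: lt_le_trans rz; rewrite divr_gt0// addr_gt0.
have -> : \sum_(j < N) r ^+ j = (1 - r ^+ N) / (1 - r).
  apply: (canRL (mulfK _)); first lra.
  by rewrite mulrC -(opprB (r ^+ N)) subrX1 -mulNr opprB.
rewrite rE; set E := r ^+ N.
have E01 : 0 <= E <= 1 by rewrite exprn_ge0 ?exprn_ile1//; lra.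
rewrite (_ : _ - _ = (1 - E) * ((K * (1 - r))^-1 - y^-1)); last first.
  by field; rewrite !pnatr_eq0 -!lt0n n0 N0 !gt_eqF.
have lo : y^-1 <= (K * (1 - r))^-1.
  rewrite lef_pV2 ?posrE ?mulr_gt0//.
  by move: r1; rewrite /z ler_pdivlMr// mulrC.
have hi : (K * (1 - r))^-1 <= y^-1 + K^-1.
  rewrite (_ : y^-1 + K^-1 = (K * (z / (1 + z)))^-1); last first.
    rewrite /z; field; rewrite !pnatr_eq0 -!lt0n n0 N0 !gt_eqF//=.
    by rewrite addr_gt0// -natrM.
  have zz0 : 0 < z / (1 + z) by rewrite divr_gt0// addr_gt0.
  by rewrite lef_pV2 ?ler_pM2l// posrE mulr_gt0.
rewrite ger0_norm; last by apply: mulr_ge0; lra.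
apply: (@le_trans _ _ (1 * ((K * (1 - r))^-1 - y^-1))); last lra.
by apply: ler_wpM2r; lra.
Qed.


Lemma GID_roots (rho : probability (mR R) R) : GID rho ->
  exists phi : nat -> R,
    (forall i, 0 <= phi i /\ laplace rho i%:R = (1 + phi i)^-1) /\
    forall n, (0 < n)%N -> exists nun : probability (mR R) R,
      on_half_line nun /\
      forall i, laplace nun i%:R = expR (- (phi i / n%:R)).
Proof.
move=> [rho0 [nu [nu0 nuID rhoE]]].
exists (fun i => - ln (laplace nu i%:R)); split.
  move=> i; rewrite oppr_ge0 ln_le0 ?laplace_le1//; split => //.
  exact: rhoE.
move=> n n0; have [nun [nun0 nunE]] := nuID n n0; exists nun; split=> // i.
have [c [cE c0 cl]] := conv_power_prob n nun0.
have -> : laplace nu i%:R = laplace nun i%:R ^+ n.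
  rewrite -cl// /laplace /Rintegral; congr fine.
  apply: eq_measure_integral => A mA _; have := nunE A mA; by rewrite cE.
have ln0 := laplace_gt0 i nun0.
rewrite lnXn// mulNr opprK -[ln _ *+ n]mulr_natr mulfK ?lnK ?posrE//.
by rewrite pnatr_eq0 -lt0n.
Qed.

(** With [y = 1 + phi], the transform of [rho - exp (- 1/n) (nun * rho)] is
    [(1 - exp (- y / n)) / y], a limit of Riemann sums that are transforms of
    positive measures of mass at most [1/n]; so this signed measure is
    positive and small, as far as polynomials in [exp (- x)] can tell. *)
Lemma expint_GID_le (rho nun : probability (mR R) R) (phi : nat -> R)
    (n : nat) q :
  on_half_line rho -> on_half_line nun -> (0 < n)%N ->
  (forall i, 0 <= phi i /\ laplace rho i%:R = (1 + phi i)^-1) ->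
  (forall k, (0 < k)%N -> exists nuk : probability (mR R) R,
      on_half_line nuk /\
      forall i, laplace nuk i%:R = expR (- (phi i / k%:R))) ->
  (forall i, laplace nun i%:R = expR (- (phi i / n%:R))) ->
  (forall u, 0 < u <= 1 -> q.[u] <= 1) ->
  expint rho q <= n%:R^-1 + expR (- n%:R^-1) * expint (conv_prob nun rho) q.
Proof.
move=> rho0 nun0 n0 rhoE roots nunE q1.
have c0 := conv_prob_half_line nun0 rho0.
(* [N] is the number of terms of the Riemann sums *)
apply: (@ler_add_div_nat _ _ (\sum_(i < size q) `|q`_i|)) => N.
set K : R := (n * N.+1)%:R.
have K0 : 0 < K by rewrite ltr0n muln_gt0 n0.
pose y i := 1 + phi i.
have y0 i : 0 < y i by rewrite ltr_pwDl//; case: (rhoE i).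
pose S i := K^-1 * \sum_(j < N.+1) expR (- (y i / K)) ^+ j.
have diffE : expint rho q - expR (- n%:R^-1) * expint (conv_prob nun rho) q =
    \sum_(i < size q) q`_i * ((1 - expR (- (y i / n%:R))) / y i).
  rewrite !expint_laplace// mulr_sumr -sumrB; apply: eq_bigr => i _.
  rewrite laplace_conv// nunE; case: (rhoE i) => _ ->; rewrite -/(y i).
  rewrite [expR (- (y i / _))](_ : _ =
    expR (- n%:R^-1) * expR (- (phi i / n%:R))); last first.
    by rewrite -expRD; congr expR; rewrite /y; ring.
  by ring.
have SE : \sum_(i < size q) q`_i * S i <= n%:R^-1.
  have [nuK [nuK0 nuKE]] : exists nuk : probability (mR R) R,
      on_half_line nuk /\ forall i, laplace nuk i%:R = expR (- (phi i / K)).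
    by apply: roots; rewrite muln_gt0 n0.
  rewrite [X in X <= _](_ : _ = K^-1 * \sum_(j < N.+1) expR (- K^-1) ^+ j *
      \sum_(i < size q) q`_i * laplace nuK i%:R ^+ j); last first.
    rewrite mulr_sumr [RHS](eq_bigr (fun j : 'I_N.+1 => \sum_(i < size q)
      K^-1 * (expR (- K^-1) ^+ j * (q`_i * laplace nuK i%:R ^+ j)))); last first.
      by move=> j _; rewrite !mulr_sumr.
    rewrite exchange_big/=; apply: eq_bigr => i _.
    rewrite /S !mulr_sumr; apply: eq_bigr => j _.
    rewrite [expR (- (y i / _))](_ : _ =
      expR (- K^-1) * expR (- (phi i / K))); last first.
      by rewrite -expRD; congr expR; rewrite /y; ring.
    by rewrite nuKE exprMn; ring.
  apply: (@le_trans _ _ (K^-1 * \sum_(j < N.+1) 1)); last first.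
    rewrite sumr_const card_ord /K natrM invfM mulrC mulrA mulrAC.
    by rewrite mulfV ?mul1r// pnatr_eq0.
  rewrite ler_pM2l ?invr_gt0//; apply: ler_sum => j _.
  have [c [_ c0' cl]] := conv_power_prob j nuK0.
  rewrite (eq_bigr (fun i : 'I_(size q) => q`_i * laplace c i%:R)); last first.
    by move=> i _; rewrite cl.
  rewrite -expint_laplace//.
  apply: (@le_trans _ _ (expR (- K^-1) ^+ j * 1)).
    rewrite ler_pM2l ?exprn_gt0 ?expR_gt0//.
    rewrite -[leRHS](expintC 1 c0'); apply: le_expint => // u u01.
    by rewrite hornerC; exact: q1.
  rewrite mulr1 exprn_ile1 ?expR_ge0// -expR0 ler_expR oppr_le0 invr_ge0.
  exact: ltW.
have : \sum_(i < size q) q`_i * ((1 - expR (- (y i / n%:R))) / y i) -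
    \sum_(i < size q) q`_i * S i <= (\sum_(i < size q) `|q`_i|) / N.+1%:R.
  rewrite -sumrB mulr_suml; apply: ler_sum => i _.
  rewrite -mulrBr; apply: (le_trans (ler_norm _)); rewrite normrM.
  rewrite ler_wpM2l// distrC.
  apply: (le_trans (riemann_sum_expR (y0 i) n0 (ltn0Sn N))).
  rewrite lef_pV2 ?posrE ?ltr0n ?muln_gt0 ?n0// ler_nat.
  by rewrite -[leqLHS]mul1n leq_mul2r n0 orbT.
rewrite -diffE; move: SE; set D := _ / _; set v := n%:R^-1; lra.
Qed.


Lemma atom_le_powers m (b : mR R -> R) (x0 : R) (K : nat) :
  on_half_line m -> measurable_fun setT b ->
  (forall x, 0 <= x -> 0 <= b x <= 1) -> 0 <= x0 -> b x0 = 1 ->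
  fine (m [set x0]) <= \int[m]_(x in `[0, +oo[) b x ^+ K.
Proof.
move=> m0 mb b01 x00 b1.
have -> : fine (m [set x0]) = \int[m]_(x in `[0, +oo[) \1_[set x0] x.
  rewrite /Rintegral integral_indic//; congr (fine (m _)).
  by apply/seteqP; split=> [x /= ->|x []//]; rewrite in_itv /= x00.
apply: le_Rintegral => //.
- apply: (@half_line_integrable _ _ (\1_[set x0]) 1) => //.
  by move=> x _; rewrite indicE; case: (_ \in _); rewrite /= ?normr1 ?normr0.
- apply: (@half_line_integrable _ _ (fun x => b x ^+ K) 1) => //.
    exact: measurable_funX.
  move=> x /b01/andP[b0 ble1].
  by rewrite normrX exprn_ile1 ?normr_ge0// ger0_norm.
- move=> x /=; rewrite in_itv /= andbT => /b01/andP[b0 _].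
  rewrite indicE; case: (boolP (x \in _)) => [|_]; last exact: exprn_ge0.
  by rewrite in_setE /= => ->; rewrite b1 expr1n.
Qed.

Lemma expN_eq1 (x : R) : (expR (- x) == 1) = (x == 0).
Proof. by rewrite -[X in _ == X]expR0 (inj_eq (@expR_inj R)) oppr_eq0. Qed.

Lemma laplace_powers m (j : nat) :
  laplace m j%:R = \int[m]_(x in `[0, +oo[) expR (- x) ^+ j.
Proof. by apply: eq_Rintegral => x _; rewrite -expRM_natl mulrN. Qed.

Lemma expN_itv_le (x : R) : 0 <= x -> 0 <= expR (- x) <= 1.
Proof. by move=> /expN_itv/andP[/ltW -> ->]. Qed.

Lemma measurable_expN :
  measurable_fun [set: mR R] ((fun x => expR (- x)) : mR R -> R).
Proof. by apply: measurableT_comp. Qed.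

(** [rho {0} = 0] says that [phi] is unbounded, that is, that the subordinator
    behind [rho] is not compound Poisson. *)
Lemma root_no_atom0 (rho nun : probability (mR R) R) (phi : nat -> R) (n : nat) :
  on_half_line rho -> rho [set 0] = 0%E -> on_half_line nun -> (0 < n)%N ->
  (forall i, 0 <= phi i /\ laplace rho i%:R = (1 + phi i)^-1) ->
  (forall i, laplace nun i%:R = expR (- (phi i / n%:R))) ->
  nun [set 0] = 0%E.
Proof.
move=> rho0 rhoz nun0 n0 rhoE nunE.
have n1 : 1 <= n%:R :> R by rewrite ler1n.
have le_ j : fine (nun [set 0]) <= n%:R * laplace rho j%:R.
  apply: (@le_trans _ _ (laplace nun j%:R)).
    rewrite laplace_powers.
    apply: (@atom_le_powers nun (fun x => expR (- x))) => //.
    - exact: measurable_expN.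
    - exact: expN_itv_le.
    - by rewrite oppr0 expR0.
  case: (rhoE j) => p0 ->; rewrite nunE expRN.
  rewrite -[leRHS]invrK invfM invrK lef_pV2 ?posrE ?expR_gt0//; last first.
    by rewrite mulr_gt0 ?invr_gt0 ?ltr0n// ltr_pwDl.
  apply: le_trans (expR_ge1Dx _); rewrite mulrDr mulr1 mulrC lerD//.
  by rewrite invf_le1// ltr0n.
have cv : (fun j => n%:R * laplace rho j%:R) @ \oo --> n%:R * fine (rho [set 0]).
  apply: cvgMr; under eq_fun do rewrite laplace_powers.
  apply: (@cvg_powers_atom _ rho (fun x => expR (- x))) => //.
  - exact: measurable_expN.
  - exact: expN_itv_le.
  - by move=> x x0; rewrite expN_eq1.
have fin0 : fine (nun [set 0]) <= 0.
  rewrite -[leRHS](mulr0 n%:R) -[X in _ * X](_ : fine (rho [set 0]) = 0).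
    exact: cvgn_ge cv le_.
  by rewrite rhoz.
apply/eqP; rewrite eq_le measure_ge0 andbT -(@fineK _ (nun [set 0])) ?lee_fin//.
exact: fin_num_measure.
Qed.

(** Every atom is dominated by the atoms at its left, since the mass at [x] is
    at most [1/n] plus an average of the masses at [x - y], [y > 0]. *)
Lemma GID_atom_le (rho : probability (mR R) R) (x c : R) :
  GID rho -> rho [set 0] = 0%E -> 0 <= c ->
  (forall z, z < x -> (rho [set z] <= c%:E)%E) -> (rho [set x] <= c%:E)%E.
Proof.
move=> GIDrho rhoz c0 le_c; have [rho0 _] := GIDrho.
have [x0|x0] := ltP x 0.
  rewrite (@le_trans _ _ 0%E) ?lee_fin// -[leRHS]rho0; apply: le_measure.
  - by rewrite inE.
  - by rewrite inE (_ : [set x | x < 0] = `]-oo, 0[%classic).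
  - by move=> _ /= ->.
have [phi [rhoE roots]] := GID_roots GIDrho.
rewrite -(@fineK _ (rho [set x])) ?lee_fin; last exact: fin_num_measure.
apply: (@ler_add_div_nat _ _ 1) => N; rewrite mul1r.
have [nun [nun0 nunE]] := roots N.+1 isT.
have nunz := root_no_atom0 rho0 rhoz nun0 (ltn0Sn N) rhoE nunE.
have c0' := conv_prob_half_line nun0 rho0.
have conv_le : fine (conv_prob nun rho [set x]) <= c.
  rewrite -lee_fin fineK ?fin_num_measure//.
  exact: conv_prob_atom_le.
(* equal to 1 at [x] only *)
pose b (y : R) := 1 - (expR (- y) - expR (- x)) ^+ 2.
have b01 y : 0 <= y -> 0 <= b y <= 1.
  move=> /expN_itv/andP[ey0 ey1]; have /andP[ex0 ex1] := expN_itv x0.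
  rewrite /b subr_ge0 -[leLHS]ger0_norm ?sqr_ge0// normrX exprn_ile1//=.
    by rewrite gerBl sqr_ge0.
  by rewrite ler_norml; lra.
have mb : measurable_fun [set: mR R] (b : mR R -> R).
  apply: measurable_funB => //; apply: measurable_funX.
  by apply: measurable_funB => //; exact: measurable_expN.
have b1 y : 0 <= y -> (b y == 1) = (y == x).
  move=> _; rewrite /b -subr_eq0 addrAC subrr add0r oppr_eq0 sqrf_eq0 subr_eq0.
  by rewrite (inj_eq (@expR_inj R)) eqr_opp.
pose q K := (1 - ('X - (expR (- x))%:P) ^+ 2) ^+ K.
have qE K u : (q K).[u] = (1 - (u - expR (- x)) ^+ 2) ^+ K.
  by rewrite /q horner_exp !hornerE.
have expintE m K : expint m (q K) = \int[m]_(y in `[0, +oo[) b y ^+ K.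
  by apply: eq_Rintegral => y _; rewrite qE.
have le_K K : fine (rho [set x]) - N.+1%:R^-1 <= expint (conv_prob nun rho) (q K).
  rewrite lerBlDl; apply: (@le_trans _ _ (expint rho (q K))).
    rewrite expintE; apply: atom_le_powers => //.
    by apply/eqP; rewrite b1.
  apply: (le_trans (expint_GID_le rho0 nun0 _ rhoE roots nunE _)) => //.
    move=> u /andP[u0 u1]; have /andP[ex0 ex1] := expN_itv x0.
    rewrite qE exprn_ile1//.
      rewrite subr_ge0 -[leLHS]ger0_norm ?sqr_ge0// normrX exprn_ile1//.
      by rewrite ler_norml; lra.
    by rewrite gerBl sqr_ge0.
  rewrite lerD2l ler_piMl//.
  by rewrite expintE; apply: Rintegral_ge0 => y /=; rewrite in_itv /= andbT
    => /b01/andP[b0 _]; exact: exprn_ge0.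
rewrite addrC -lerBlDl; apply: le_trans conv_le.
have cv := cvg_powers_atom c0' mb b01 x0 b1.
by apply: (cvgn_ge cv) => K; rewrite -expintE; exact: le_K.
Qed.

(** The potential measure of a subordinator that is not compound Poisson has
    no atom: the atoms larger than [c] would admit no leftmost element, so
    there would be infinitely many of them. *)
Theorem GID_atomless (rho : probability (mR R) R) (x : R) :
  GID rho -> rho [set 0] = 0%E -> rho [set x] = 0%E.
Proof.
move=> GIDrho rhoz; apply/eqP; rewrite eq_le measure_ge0 andbT.
apply/lee_addgt0Pr => c c0; rewrite add0e leNgt; apply/negP => xc.
(* [k] atoms larger than [c] to the left of every atom larger than [c] *)
have desc k : forall z, (c%:E < rho [set z])%E ->
    ((k%:R * c)%:E <= rho `]-oo, z]%classic)%E.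
  elim: k => [|k IHk] z zc; first by rewrite mul0r measure_ge0.
  have [z' z'z z'c] : exists2 z', z' < z & (c%:E < rho [set z'])%E.
    apply/not_exists2P => nz; move: zc; rewrite ltNge => /negP; apply.
    apply: GID_atom_le (ltW c0) _ => // z' z'z; rewrite leNgt; apply/negP => z'c.
    by case: (nz z').
  apply: (@le_trans _ _ (rho (`]-oo, z']%classic `|` [set z]))).
    rewrite measureU//; last first.
      apply/seteqP; split => // y [/=]; rewrite in_itv /= => + yz.
      by rewrite yz leNgt z'z.
    rewrite mulrSr mulrDl mul1r EFinD; apply: leeD; [exact: IHk|exact: ltW].
  apply: le_measure; rewrite ?inE//; first exact: measurableU.
  move=> y /= []; rewrite !in_itv /=; last by move=> ->.
  by move=> /le_trans; apply; exact: ltW.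
have /ltr_add_invr[k] : 0 < c by [].
rewrite add0r => kc.
have := le_trans (desc k.+1 _ xc) (probability_le1 rho (measurable_itv _)).
by rewrite lee_fin leNgt -ltr_pdivrMl// mulr1 kc.
Qed.

End GIDAtoms.

(** * Convolution of a function with a measure *)

Section ConvFun.
Context {R : realType}.
Implicit Types (kappa : {measure set (mR R) -> \bar R}) (F G : R -> R).

(** Every function convolved below is of this kind, so that its integrals over
    bounded intervals against locally finite measures are finite. *)
Definition bounded_mfun (M : R) F : Prop :=
  measurable_fun setT (F : mR R -> R) /\ forall x, 0 <= F x <= M.

Lemma locally_finite_itv kappa (t : R) : locally_finite kappa ->
  (kappa `[0%R, t]%classic < +oo)%E.
Proof.
move=> kfin; apply: kfin => //; exists (`|t|); split; first exact: num_real.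
move=> M tM x /=; rewrite in_itv /= => /andP[x0 xt].
rewrite ger0_norm//; apply: (le_trans xt); apply: (le_trans (ler_norm t)).
exact: ltW.
Qed.

Lemma probability_locally_finite (m : probability (mR R) R) : locally_finite m.
Proof. by move=> A mA _; rewrite ltey_eq fin_num_measure. Qed.

Lemma bounded_mfunD (M N : R) F G : bounded_mfun M F -> bounded_mfun N G ->
  bounded_mfun (M + N) (fun x => F x + G x).
Proof.
move=> [mF F0] [mG G0]; split; first exact: measurable_funD.
by move=> x; case/andP: (F0 x); case/andP: (G0 x) => *; apply/andP; split; lra.
Qed.

Lemma bounded_mfunZ (M c : R) F : 0 <= c -> bounded_mfun M F ->
  bounded_mfun (c * M) (fun x => c * F x).
Proof.
move=> c0 [mF F0]; split; first exact: measurable_funM.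
move=> x; case/andP: (F0 x) => F0x FM.
by rewrite mulr_ge0//= ler_wpM2l.
Qed.

Lemma bounded_mfunX (M : R) n F : bounded_mfun M F ->
  bounded_mfun (M ^+ n) (fun x => F x ^+ n).
Proof.
move=> [mF F0]; split; first exact: measurable_funX.
move=> x; case/andP: (F0 x) => F0x FM; rewrite exprn_ge0//=.
by apply: lerXn2r => //; rewrite nnegrE// (le_trans F0x).
Qed.

Lemma bounded_mfun_cst (M : R) : 0 <= M -> bounded_mfun M (fun=> M).
Proof. by move=> M0; split=> // _; rewrite M0 lexx. Qed.

Lemma bounded_mfun_le (M N : R) F : M <= N -> bounded_mfun M F ->
  bounded_mfun N F.
Proof.
by move=> MN [mF F0]; split=> // x; case/andP: (F0 x) => -> /le_trans ->.
Qed.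

Lemma measurable_reflect F (t : R) : measurable_fun setT (F : mR R -> R) ->
  measurable_fun setT ((fun s => F (t - s)) : mR R -> R).
Proof. by move=> mF; apply: measurableT_comp => //; exact: measurable_funB. Qed.

Lemma conv_integrable kappa (M : R) F (t : R) : locally_finite kappa ->
  bounded_mfun M F -> kappa.-integrable `[0, t] (EFin \o (fun s => F (t - s))).
Proof.
move=> kfin [mF F0]; apply: (@bounded_integrable _ _ _ _ M) => //.
- exact: locally_finite_itv.
- exact: measurable_reflect.
- by move=> x _; case/andP: (F0 (t - x)) => ? ?; rewrite ger0_norm.
Qed.

Lemma conv_fun_ge0 kappa F (t : R) : (forall x, 0 <= F x) ->
  0 <= conv_fun F kappa t.
Proof. by move=> F0; apply: Rintegral_ge0. Qed.

Lemma le_conv_fun kappa (M N : R) F G (t : R) : locally_finite kappa ->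
  bounded_mfun M F -> bounded_mfun N G -> (forall x, F x <= G x) ->
  conv_fun F kappa t <= conv_fun G kappa t.
Proof.
move=> kfin bF bG FG; apply: le_Rintegral => //.
- exact: conv_integrable bF.
- exact: conv_integrable bG.
Qed.

Lemma conv_funD kappa (M N : R) F G (t : R) : locally_finite kappa ->
  bounded_mfun M F -> bounded_mfun N G ->
  conv_fun (fun x => F x + G x) kappa t = conv_fun F kappa t + conv_fun G kappa t.
Proof.
move=> kfin bF bG; rewrite /conv_fun RintegralD//.
- exact: conv_integrable bF.
- exact: conv_integrable bG.
Qed.

Lemma conv_funZ kappa (M c : R) F (t : R) : locally_finite kappa ->
  bounded_mfun M F ->
  conv_fun (fun x => c * F x) kappa t = c * conv_fun F kappa t.
Proof.
by move=> kfin bF; rewrite /conv_fun RintegralZl//; exact: conv_integrable bF.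
Qed.

Lemma conv_fun_cst kappa (c : R) (t : R) :
  conv_fun (fun=> c) kappa t = c * fine (kappa `[0, t]%classic).
Proof. by rewrite /conv_fun Rintegral_cst. Qed.

Lemma conv_fun_sum kappa (M : R) n (F : nat -> R -> R) (t : R) :
  locally_finite kappa -> (forall k, bounded_mfun M (F k)) ->
  conv_fun (fun x => \sum_(k < n) F k x) kappa t =
  \sum_(k < n) conv_fun (F k) kappa t.
Proof.
move=> kfin bF; rewrite /conv_fun Rintegral_sum// => k.
exact: conv_integrable (bF k).
Qed.

Lemma prob_itv_le1 (m : probability (mR R) R) (t : R) :
  0 <= fine (m `[0, t]%classic) <= 1.
Proof.
rewrite fine_ge0//= -lee_fin fineK ?fin_num_measure//.
exact: probability_le1.
Qed.

Lemma measurable_conv_fun (m : probability (mR R) R) (M : R) F :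
  bounded_mfun M F -> measurable_fun setT (conv_fun F m : mR R -> R).
Proof.
move=> [mF F0].
(* the domain of integration, encoded in a jointly measurable integrand *)
pose G (p : mR R * mR R) : R :=
  (F (p.1 - p.2) * \1_(`[0, +oo[%classic : set (mR R)) p.2) *
  \1_(`[0, +oo[%classic : set (mR R)) (p.1 - p.2).
have mB : measurable_fun [set: mR R * mR R] (fun p => p.1 - p.2 : mR R).
  by apply: measurable_funB; [exact: measurable_fst|exact: measurable_snd].
have mG : measurable_fun [set: mR R * mR R] (EFin \o G).
  apply/measurable_EFinP; apply: measurable_funM; [apply: measurable_funM|].
  - exact: (measurableT_comp mF mB).
  - by apply: measurableT_comp; [exact: measurable_indic|exact: measurable_snd].
  - by apply: (measurableT_comp _ mB); exact: measurable_indic.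
have G0 p : (0 <= (EFin \o G) p)%E.
  rewrite lee_fin /G !mulr_ge0 ?indicE//.
  by case/andP: (F0 (p.1 - p.2)).
rewrite (_ : conv_fun F m = fun t => fine (fubini_F m (EFin \o G) t)).
  apply: (measurableT_comp (fine_measurable measurableT)).
  exact: measurable_fun_fubini_tonelli_F.
apply/funext => t; rewrite /conv_fun Rintegral_mkcond /Rintegral; congr fine.
apply: eq_integral => s _; congr EFin.
rewrite /G /= patchE !indicE !mem_setE !in_itv /= !andbT subr_ge0.
by case: (0 <= s); case: (s <= t); rewrite ?mulr1 ?mulr0// mul0r.
Qed.

Lemma bounded_conv_fun (m : probability (mR R) R) (M : R) F : 0 <= M ->
  bounded_mfun M F -> bounded_mfun M (conv_fun F m).
Proof.
move=> M0 bF; split; first exact: measurable_conv_fun bF.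
case: (bF) => _ F0 t; rewrite conv_fun_ge0/=; last first.
  by move=> x; case/andP: (F0 x).
apply: (@le_trans _ _ (conv_fun (fun=> M) m t)).
  apply: le_conv_fun bF (bounded_mfun_cst M0) _ => //.
    exact: probability_locally_finite.
  by move=> x; case/andP: (F0 x).
rewrite conv_fun_cst; case/andP: (prob_itv_le1 m t) => ? ?.
by rewrite ler_piMr.
Qed.

End ConvFun.

(** * Solving the equation for h[f] *)

(** Why the interval [0, 2 e] is preserved by the Picard iteration below. *)
Lemma picard_step_le (R : realType) (e : R) : 0 <= e -> e <= 4^-1 ->
  e + 2^-1 * (2 * e) ^+ 2 <= 2 * e.
Proof. by move=> e0 e4; nra. Qed.

Section Riccati.
Context {R : realType} (rho : probability (mR R) R).

Fixpoint picard (f : R -> R) (n : nat) : R -> R :=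
  if n is k.+1
  then conv_fun (fun s => f s + 2^-1 * picard f k s ^+ 2) rho
  else fun=> 0.

Variables (f : R -> R) (e : R).
Hypotheses (e0 : 0 <= e) (e4 : e <= 4^-1) (fe : bounded_mfun e f).

Lemma riccati_rhs_bounded (h : R -> R) : bounded_mfun (2 * e) h ->
  bounded_mfun (2 * e) (fun s => f s + 2^-1 * h s ^+ 2).
Proof.
move=> bh; apply: (@bounded_mfun_le _ (e + 2^-1 * (2 * e) ^+ 2)).
  exact: picard_step_le.
by apply: bounded_mfunD => //; apply: bounded_mfunZ => //; exact: bounded_mfunX.
Qed.

Lemma picard_bounded n : bounded_mfun (2 * e) (picard f n).
Proof.
elim: n => [|n IHn] /=; first by split=> // x; rewrite lexx mulr_ge0.
by apply: bounded_conv_fun; [rewrite mulr_ge0|exact: riccati_rhs_bounded].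
Qed.

Lemma picard_nondecreasing (t : R) :
  nondecreasing_seq (fun n => picard f n t).
Proof.
apply/nondecreasing_seqP => n; elim: n t => [|n IHn] t.
  by case: (picard_bounded 1) => _ /(_ t)/andP[].
apply: (le_conv_fun _ (probability_locally_finite rho)
  (riccati_rhs_bounded (picard_bounded n))
  (riccati_rhs_bounded (picard_bounded n.+1))) => x.
rewrite lerD2l ler_wpM2l// lerXn2r ?nnegrE//.
  by case: (picard_bounded n) => _ /(_ x)/andP[].
by case: (picard_bounded n.+1) => _ /(_ x)/andP[].
Qed.

Lemma picard_cvg (t : R) : cvgn (fun n => picard f n t).
Proof.
apply: nondecreasing_is_cvgn; first exact: picard_nondecreasing.
exists (2 * e) => _ [n _ <-].
by case: (picard_bounded n) => _ /(_ t)/andP[].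
Qed.

(** The characterization of the law sees [h[f]] only as a solution of its
    equation, so a solution has to be exhibited; for small [f >= 0] the Picard
    iterates increase to one. *)
Lemma riccati_exists : exists h : R -> R,
  [/\ riccati_solution rho f h, bounded_mfun (2 * e) h &
      forall t, h t = conv_fun (fun s => f s + 2^-1 * h s ^+ 2) rho t].
Proof.
pose h t := limn (fun n => picard f n t).
have hP t : (fun n => picard f n t) @ \oo --> h t by exact: picard_cvg.
have bh : bounded_mfun (2 * e) h.
  split.
    apply: (@measurable_fun_cvg _ _ _ _ (picard f)) => // n.
    by case: (picard_bounded n).
  move=> t; apply/andP; split.
    apply: (cvgn_ge (hP t)) => n.
    by case: (picard_bounded n) => _ /(_ t)/andP[].
  rewrite -lerN2; apply: (@cvgn_ge _ (fun n => - picard f n t)).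
    exact: cvgN (hP t).
  by move=> n; rewrite lerN2; case: (picard_bounded n) => _ /(_ t)/andP[].
have hE t : h t = conv_fun (fun s => f s + 2^-1 * h s ^+ 2) rho t.
  have cv : (fun n => picard f n.+1 t) @ \oo -->
      conv_fun (fun s => f s + 2^-1 * h s ^+ 2) rho t.
    have ih := conv_integrable t (probability_locally_finite rho)
      (riccati_rhs_bounded bh).
    apply: fine_cvg; rewrite fineK; last exact: integrable_fin_num ih.
    apply: (@dominated_cvg _ _ _ rho _ (measurable_itv _)
      (fun n s => (f (t - s) + 2^-1 * picard f n (t - s) ^+ 2)%:E)
      (fun s => (f (t - s) + 2^-1 * h (t - s) ^+ 2)%:E)
      (fun=> (2 * e)%:E)) => //.
    - move=> n; apply/measurable_EFinP; apply: measurable_funTS.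
      apply: (@measurable_reflect R (fun s => f s + 2^-1 * picard f n s ^+ 2)).
      by case: (riccati_rhs_bounded (picard_bounded n)).
    - move=> s _; apply: cvg_EFin; first by near=> n.
      apply: cvgD; first exact: cvg_cst.
      apply: cvgMr; under eq_fun do rewrite expr2.
      by rewrite expr2; apply: cvgM; exact: hP.
    - apply: (@bounded_integrable _ _ _ (fun=> 2 * e) `|2 * e|) => //.
      exact/locally_finite_itv/probability_locally_finite.
    - move=> n s _; case: (riccati_rhs_bounded (picard_bounded n)) => _.
      by move=> /(_ (t - s))/andP[? ?]; rewrite lee_fin ger0_norm.
  have cv' : (fun n => picard f n.+1 t) @ \oo --> h t.
    by have := hP t; rewrite -cvg_shiftS.
  by rewrite -(cvg_lim _ cv)// -(cvg_lim _ cv').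
exists h; split => //; split => //.
- by case: bh => mh _; exact: measurable_funTS.
- move=> T; exists (2 * e) => t _.
  by case: bh => _ /(_ t)/andP[? ?]; rewrite ger0_norm.
Unshelve. all: by end_near.
Qed.

End Riccati.

(** * Second moments of the random measure *)

Section SecondMoment.
Context {R : realType}.

Lemma bounded_affine (M N a b c : R) (F G : R -> R) :
  0 <= a -> 0 <= b -> 0 <= c -> bounded_mfun M F -> bounded_mfun N G ->
  bounded_mfun (a * M + b * N + c) (fun x => a * F x + b * G x + c).
Proof.
move=> a0 b0 c0 bF bG; apply: bounded_mfunD; last exact: bounded_mfun_cst.
by apply: bounded_mfunD; exact: bounded_mfunZ.
Qed.

Lemma conv_fun_affine (kappa : {measure set (mR R) -> \bar R})
    (M N a b c : R) (F G : R -> R) (t : R) : locally_finite kappa ->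
  0 <= a -> 0 <= b -> 0 <= c -> bounded_mfun M F -> bounded_mfun N G ->
  conv_fun (fun x => a * F x + b * G x + c) kappa t =
  a * conv_fun F kappa t + b * conv_fun G kappa t +
  c * fine (kappa `[0, t]%classic).
Proof.
move=> kfin a0 b0 c0 bF bG.
have bZF := bounded_mfunZ a0 bF; have bZG := bounded_mfunZ b0 bG.
rewrite (conv_funD _ kfin (bounded_mfunD bZF bZG) (bounded_mfun_cst c0)).
rewrite (conv_funD _ kfin bZF bZG) (conv_funZ _ _ kfin bF) (conv_funZ _ _ kfin bG).
by rewrite conv_fun_cst.
Qed.

(** [a1] and [a2] are the exponents of the exponential moments at scales [e]
    and [2 e]. As [exp a2 + 1 - 2 exp a1] equals
    [(exp a1 - 1) ^ 2 + (exp a2 - exp (2 a1))], its leading term needs [a1] to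
    first order and [a2 - 2 a1] to second order in [e]. *)
Lemma exponential_defect_le (a1 a2 G Q M e : R) :
  0 < e -> e <= 8^-1 -> 0 <= G <= M -> 0 <= Q <= M ->
  e * G + 2^-1 * e ^+ 2 * Q <= a1 -> a1 <= e * G + 2 * e ^+ 2 * M ->
  a2 <= 2 * e * G + 2 * e ^+ 2 * Q + 20 * e ^+ 3 * M -> a2 <= M ->
  expR a2 + 1 - 2 * expR a1 <=
  e ^+ 2 * (expR M * (G ^+ 2 + Q + e * (8 * M ^+ 2 + 20 * M))).
Proof.
move=> e0 e8 /andP[G0 GM] /andP[Q0 QM] a1lo a1hi a2hi a2M.
have e_ge0 : 0 <= e := ltW e0.
have a1_ge0 : 0 <= a1.
  by apply: le_trans a1lo; rewrite addr_ge0 ?mulr_ge0 ?exprn_ge0.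
have M0 : 0 <= M := le_trans G0 GM.
have a1M : 2 * a1 <= M.
  have eM : e * M <= 8^-1 * M by rewrite ler_wpM2r.
  have eG : e * G <= e * M by rewrite ler_pM2l.
  have e2M : e ^+ 2 * M <= 8^-1 * (e * M).
    by rewrite expr2 -mulrA ler_wpM2r// mulr_ge0// ltW.
  by lra.
have defect : a2 - 2 * a1 <= e ^+ 2 * Q + 20 * e ^+ 3 * M by lra.
have defect0 : 0 <= e ^+ 2 * Q + 20 * e ^+ 3 * M.
  by rewrite addr_ge0// !mulr_ge0 ?exprn_ge0.
have sq : (expR a1 - 1) ^+ 2 <= expR M * a1 ^+ 2.
  apply: (@le_trans _ _ ((expR a1 * a1) ^+ 2)).
    rewrite lerXn2r ?nnegrE ?mulr_ge0 ?expR_ge0 ?subr_ge0//.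
      by rewrite -[leLHS]expR0 ler_expR.
    have := expR_ge1Dx (- a1); rewrite expRN => h.
    have := ler_wpM2l (expR_ge0 a1) h.
    by rewrite mulfV ?gt_eqF ?expR_gt0//; lra.
  rewrite exprMn ler_wpM2r ?sqr_ge0// -expRM_natl ler_expR//.
have diff : expR a2 - expR (2 * a1) <= expR M * (e ^+ 2 * Q + 20 * e ^+ 3 * M).
  apply: (@le_trans _ _ (expR a2 * (a2 - 2 * a1))).
    have := expR_ge1Dx (- (a2 - 2 * a1)) => h.
    have := ler_wpM2l (expR_ge0 a2) h.
    by rewrite -expRD (_ : a2 + - (a2 - 2 * a1) = 2 * a1); [lra|ring].
  apply: (@le_trans _ _ (expR a2 * (e ^+ 2 * Q + 20 * e ^+ 3 * M))).
    by rewrite ler_wpM2l// expR_ge0.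
  by rewrite ler_wpM2r// ler_expR.
have -> : expR a2 + 1 - 2 * expR a1 =
    (expR a1 - 1) ^+ 2 + (expR a2 - expR (2 * a1)).
  by rewrite [expR (2 * a1)]expRM_natl; ring.
apply: (le_trans (lerD sq diff)).
rewrite -mulrDr [leRHS]mulrCA; apply: ler_wpM2l; first exact: expR_ge0.
have : a1 ^+ 2 <= (e * G + 2 * e ^+ 2 * M) ^+ 2.
  by rewrite lerXn2r ?nnegrE// addr_ge0// ?mulr_ge0 ?exprn_ge0.
move=> a1sq; apply: (le_trans (lerD a1sq (lexx _))).
have -> : (e * G + 2 * e ^+ 2 * M) ^+ 2 + (e ^+ 2 * Q + 20 * e ^+ 3 * M) =
  e ^+ 2 * (G ^+ 2 + Q + e * (4 * (G * M) + 4 * e * M ^+ 2 + 20 * M)) by ring.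
rewrite ler_wpM2l ?sqr_ge0// lerD2l ler_wpM2l//.
rewrite lerD2r.
have GMM : G * M <= M ^+ 2 by rewrite expr2 ler_wpM2r.
have eMM : e * M ^+ 2 <= M ^+ 2 by rewrite ler_piMl ?sqr_ge0//; lra.
by lra.
Qed.

End SecondMoment.
Section FellerSecondMoment.
Context {R : realType}.

Lemma kernel_measurable_conv_fun (d : measure_display)
    (Omega : measurableType d) (xi : R.-ker Omega ~> measurableTypeR R)
    (M : R) (F : R -> R) (t : R) :
  bounded_mfun M F -> measurable_fun setT (fun w => conv_fun F (xi w) t).
Proof.
move=> [mF F0].
pose k := (fun s : mR R => (F (t - s))%:E) \_ (`[0, t]%classic : set (mR R)).
rewrite (_ : (fun w => _) = fun w => fine (\int[xi w]_s k s)%E).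
  apply: (measurableT_comp (fine_measurable measurableT)).
  apply: measurable_fun_integral_kernel.
  - by move=> U mU; exact: measurable_kernel.
  - move=> s; apply: erestrict_ge0 => x _; rewrite lee_fin.
    by case/andP: (F0 (t - x)).
  - apply/(measurable_restrictT _ _).1 => //.
    apply/measurable_EFinP; apply: measurable_funTS.
    exact: measurable_reflect.
by apply/funext => w; rewrite -integral_mkcond.
Qed.

(** This is [x ^ 2 <= (exp x - 1) ^ 2] for [x >= 0], integrated. *)
Lemma second_moment_of_exponential (d : measure_display)
    (Omega : measurableType d) (P : probability Omega R) (X : Omega -> R)
    (A1 A2 : R) :
  measurable_fun setT X -> (forall w, 0 <= X w) ->
  (\int[P]_w (expR (X w))%:E)%E = A1%:E ->
  (\int[P]_w (expR (2 * X w))%:E)%E = A2%:E ->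
  (\int[P]_w (X w ^+ 2)%:E <= (A2 + 1 - 2 * A1)%:E)%E.
Proof.
move=> mX X0 E1 E2.
have mX2 : measurable_fun setT (fun w => X w ^+ 2) by exact: measurable_funX.
have me : measurable_fun setT (fun w => expR (X w)) by exact: measurableT_comp.
have me2 : measurable_fun setT (fun w => expR (2 * X w)).
  by apply: measurableT_comp => //; exact: measurable_funM.
have lhsE : (\int[P]_w (X w ^+ 2 + 2 * expR (X w))%:E =
    \int[P]_w (X w ^+ 2)%:E + 2%:E * A1%:E)%E.
  rewrite -E1 -ge0_integralZl//; last exact/measurable_EFinP.
  rewrite -ge0_integralD//.
  - by move=> w _; rewrite lee_fin sqr_ge0.
  - exact/measurable_EFinP.
  - by apply/measurable_EFinP; exact: measurable_funM.
have rhsE : (\int[P]_w (expR (2 * X w) + 1)%:E = A2%:E + 1%:E)%E.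
  under eq_integral do rewrite EFinD.
  rewrite ge0_integralD//; last exact/measurable_EFinP.
  by rewrite E2 integral_cst// mul1e [X in (_ + X)%E]probability_setT.
rewrite EFinB EFinD EFinM leeBrDr// -lhsE -rhsE; apply: ge0_le_integral => //.
- by move=> w _; rewrite lee_fin addr_ge0// ?mulr_ge0 ?sqr_ge0 ?expR_ge0.
- apply/measurable_EFinP; apply: measurable_funD => //; exact: measurable_funM.
- by apply/measurable_EFinP; exact: measurable_funD.
- move=> w _; rewrite lee_fin expRM_natl.
  have : X w ^+ 2 <= (expR (X w) - 1) ^+ 2.
    have := expR_ge1Dx (X w) => h.
    by rewrite lerXn2r ?nnegrE//; have := X0 w; lra.
  by lra.
Qed.

Variables (rho : probability (mR R) R) (mu : {measure set (mR R) -> \bar R}).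
Hypothesis mu_fin : locally_finite mu.
Variables (d : measure_display) (Omega : measurableType d).
Variables (P : probability Omega R) (xi : R.-ker Omega ~> measurableTypeR R).
Hypothesis xi_Feller : Feller_random_measure P mu rho xi.

Local Notation X F t w := (conv_fun F (xi w) t).

Let xi_fin w : locally_finite (xi w).
Proof. by case: xi_Feller => /(_ w)[]. Qed.

Lemma test_functionZ (f : R -> R) (c : R) : continuous f -> f 0 = 0 ->
  bounded_mfun 1 f -> 0 <= c <= 2^-1 -> test_function (fun x => c * f x).
Proof.
move=> cf f00 [_ f01] /andP[c0 c2]; split; last 2 first.
- by rewrite f00 mulr0.
- move=> t _; case/andP: (f01 t) => ft0 ft1.
  by rewrite ger0_norm ?mulr_ge0// (le_trans _ c2)// ler_piMr.
apply: continuous_subspaceT => x; apply: cvgMr; exact: cf.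
Qed.

(** The exponential moment of [X f] at scale [c], read off from the
    characterization with the test function [c f]. *)
Lemma exponential_moment (f h : R -> R) (c t : R) :
  continuous f -> f 0 = 0 -> bounded_mfun 1 f -> 0 <= c <= 2^-1 ->
  riccati_solution rho (fun x => c * f x) h -> 0 <= t ->
  (\int[P]_w (expR (c * X f t w))%:E)%E = (expR (conv_fun h mu t))%:E.
Proof.
move=> cf f00 bf c01 hsol t0.
case: xi_Feller => _ /(_ _ _ (test_functionZ cf f00 bf c01) hsol t t0) <-.
rewrite expectation.unlock; apply: eq_integral => w _; congr (expR _)%:E.
by rewrite (conv_funZ _ _ (xi_fin w) bf).
Qed.

(** At [e = 0] this is [expR M] times the second moment of [X f t], written as
    the square of the mean plus the variance. *)
Definition moment_bound (f : R -> R) (t e : R) : R :=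
  let g := conv_fun f rho in
  let M := fine (mu `[0, t]%classic) in
  expR M * (conv_fun g mu t ^+ 2 +
            conv_fun (conv_fun (fun x => g x ^+ 2) rho) mu t +
            e * (8 * M ^+ 2 + 20 * M)).

Lemma second_moment_scaled (f : R -> R) (e t : R) :
  continuous f -> f 0 = 0 -> bounded_mfun 1 f -> 0 < e -> e <= 8^-1 -> 0 <= t ->
  (\int[P]_w ((X f t w) ^+ 2)%:E <= (moment_bound f t e)%:E)%E.
Proof.
move=> cf f00 bf e0 e8 t0; rewrite /moment_bound /=.
set g := conv_fun f rho; set G := conv_fun g mu t.
set M := fine (mu `[0, t]%classic); set Q := conv_fun (conv_fun _ _) mu t.
have e_ge0 : 0 <= e := ltW e0.
have e4 : e <= 4^-1 by lra.
have ee4 : 2 * e <= 4^-1 by lra.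
have ee0 : 0 <= 2 * e by lra.
have e2 : 0 <= e <= 2^-1 by lra.
have ee2 : 0 <= 2 * e <= 2^-1 by lra.
have rho_fin := probability_locally_finite rho.
have bg : bounded_mfun 1 g by exact: bounded_conv_fun.
have bg2 : bounded_mfun 1 (fun x => g x ^+ 2).
  by have := bounded_mfunX 2 bg; rewrite expr1n.
pose k := conv_fun (fun x => g x ^+ 2) rho.
have bk : bounded_mfun 1 k by exact: bounded_conv_fun.
have M0 : 0 <= M by exact: fine_ge0.
have unit_le F : bounded_mfun 1 F -> 0 <= conv_fun F mu t <= M.
  move=> bF; rewrite conv_fun_ge0/=; last by case: bF => _ F0 x; case/andP: (F0 x).
  rewrite -[leRHS]mul1r -conv_fun_cst.
  apply: (le_conv_fun _ mu_fin bF (bounded_mfun_cst ler01)) => x.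
  by case: bF => _ /(_ x)/andP[].
have sol c : 0 <= c -> c <= 4^-1 -> exists h, [/\
    riccati_solution rho (fun x => c * f x) h, bounded_mfun (2 * c) h,
    forall x, h x <= c * g x + 2 * c ^+ 2 &
    forall x, h x = c * g x + 2^-1 * conv_fun (fun s => h s ^+ 2) rho x].
  move=> c0 c4; have bcf : bounded_mfun c (fun x => c * f x).
    by have := bounded_mfunZ c0 bf; rewrite mulr1.
  have [h [hs bh hE]] := riccati_exists rho c0 c4 bcf.
  have bh2 := bounded_mfunX 2 bh.
  have hE' x : h x = c * g x + 2^-1 * conv_fun (fun s => h s ^+ 2) rho x.
    rewrite {1}hE (conv_funD _ rho_fin bcf (bounded_mfunZ _ bh2))//.
    by rewrite (conv_funZ _ _ rho_fin bf) (conv_funZ _ _ rho_fin bh2).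
  exists h; split => // x; rewrite hE' lerD2l.
  have : conv_fun (fun s => h s ^+ 2) rho x <= (2 * c) ^+ 2.
    by have [_ /(_ x)/andP[]] := bounded_conv_fun rho (sqr_ge0 _) bh2.
  by rewrite exprMn; lra.
have [h1 [h1s bh1 h1le h1E]] := sol e e_ge0 e4.
have [h2 [h2s bh2 h2le h2E]] := sol (2 * e) ee0 ee4.
have g01 x : 0 <= g x <= 1 by case: bg.
have k0 x : 0 <= k x by case: bk => _ /(_ x)/andP[].
have h10 x : 0 <= h1 x by case: bh1 => _ /(_ x)/andP[].
have h20 x : 0 <= h2 x by case: bh2 => _ /(_ x)/andP[].
(* second order lower bound for [h1] *)
have h1lo x : e * g x + (2^-1 * e ^+ 2) * k x <= h1 x.
  rewrite [leRHS]h1E lerD2l -mulrA ler_wpM2l//.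
  rewrite -(conv_funZ _ _ rho_fin bg2).
  apply: (le_conv_fun _ rho_fin (bounded_mfunZ _ bg2) (bounded_mfunX 2 bh1)).
    exact: sqr_ge0.
  move=> y; rewrite -exprMn lerXn2r ?nnegrE// ?mulr_ge0//; last first.
    rewrite h1E lerDl mulr_ge0// conv_fun_ge0// => z; exact: sqr_ge0.
  by case/andP: (g01 y).
(* second order upper bound for [h2], with an error of order 3 *)
have h2hi x : h2 x <= (2 * e) * g x + (2 * e ^+ 2) * k x + 20 * e ^+ 3.
  rewrite [leLHS]h2E -addrA lerD2l.
  have h2sq y : h2 y ^+ 2 <= (4 * e ^+ 2) * g y ^+ 2 + 0 * g y ^+ 2 + 40 * e ^+ 3.
    apply: (@le_trans _ _ ((2 * e * g y + 2 * (2 * e) ^+ 2) ^+ 2)).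
      rewrite lerXn2r ?nnegrE// (le_trans (h20 y))//; exact: h2le.
    have -> : (2 * e * g y + 2 * (2 * e) ^+ 2) ^+ 2 =
      4 * e ^+ 2 * g y ^+ 2 + (e ^+ 3) * (32 * g y + 64 * e) by ring.
    rewrite mul0r addr0 lerD2l mulrC ler_wpM2r ?exprn_ge0//.
    by case/andP: (g01 y) => *; lra.
  have a0 : 0 <= 4 * e ^+ 2 by rewrite mulr_ge0// sqr_ge0.
  have c0 : 0 <= 40 * e ^+ 3 by rewrite mulr_ge0// exprn_ge0.
  have := le_conv_fun x rho_fin (bounded_mfunX 2 bh2)
    (bounded_affine a0 (lexx 0) c0 bg2 bg2) h2sq.
  rewrite (conv_fun_affine _ rho_fin a0 (lexx 0) c0 bg2 bg2) -/(k x).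
  case/andP: (prob_itv_le1 rho x) => _ r1.
  have := ler_wpM2l c0 r1; lra.
have mX : measurable_fun setT (fun w => X f t w).
  exact: kernel_measurable_conv_fun bf.
have X0 w : 0 <= e * X f t w.
  by rewrite mulr_ge0// conv_fun_ge0// => x; case: bf => _ /(_ x)/andP[].
have E1 := exponential_moment cf f00 bf e2 h1s t0.
have := exponential_moment cf f00 bf ee2 h2s t0.
under eq_integral do rewrite -mulrA.
move=> E2; have key := second_moment_of_exponential
  (measurable_funM (measurable_cst e) mX) X0 E1 E2.
have eq0 : 0 <= 2^-1 * e ^+ 2 by rewrite mulr_ge0// sqr_ge0.
have eq2 : 0 <= 2 * e ^+ 2 by rewrite mulr_ge0// sqr_ge0.
have eq3 : 0 <= 20 * e ^+ 3 by rewrite mulr_ge0// exprn_ge0.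
have a1lo : e * G + 2^-1 * e ^+ 2 * Q <= conv_fun h1 mu t.
  have := le_conv_fun t mu_fin (bounded_affine e_ge0 eq0 (lexx 0) bg bk) bh1.
  rewrite (conv_fun_affine _ mu_fin e_ge0 eq0 (lexx 0) bg bk) mul0r addr0.
  by apply => x; rewrite addr0.
have a1hi : conv_fun h1 mu t <= e * G + 2 * e ^+ 2 * M.
  have := le_conv_fun t mu_fin bh1 (bounded_affine e_ge0 (lexx 0) eq2 bg bk).
  rewrite (conv_fun_affine _ mu_fin e_ge0 (lexx 0) eq2 bg bk) mul0r addr0.
  by apply => x; rewrite mul0r addr0.
have a2hi : conv_fun h2 mu t <= 2 * e * G + 2 * e ^+ 2 * Q + 20 * e ^+ 3 * M.
  have := le_conv_fun t mu_fin bh2 (bounded_affine ee0 eq2 eq3 bg bk) h2hi.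
  by rewrite (conv_fun_affine _ mu_fin ee0 eq2 eq3 bg bk).
have a2M : conv_fun h2 mu t <= M.
  have bh2' : bounded_mfun 1 h2 by apply: bounded_mfun_le bh2; lra.
  by case/andP: (unit_le _ bh2').
have GM := unit_le _ bg; have QM := unit_le _ bk.
have := exponential_defect_le e0 e8 GM QM a1lo a1hi a2hi a2M.
rewrite -lee_fin => /(le_trans key).
rewrite (_ : (\int[P]_w ((e * X f t w) ^+ 2)%:E =
  (e ^+ 2)%:E * \int[P]_w (X f t w ^+ 2)%:E)%E); last first.
  rewrite -ge0_integralZl//; last 3 first.
  - exact/measurable_EFinP/measurable_funX.
  - by move=> w _; rewrite lee_fin sqr_ge0.
  - by rewrite lee_fin sqr_ge0.
  by apply: eq_integral => w _; rewrite -EFinM exprMn.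
by rewrite [Y in (_ <= Y)%E -> _]EFinM lee_pmul2l// lte_fin exprn_gt0.
Qed.

(** The previous bound as [e] tends to 0. *)
Lemma second_moment_le (f : R -> R) (t : R) :
  continuous f -> f 0 = 0 -> bounded_mfun 1 f -> 0 <= t ->
  (\int[P]_w ((X f t w) ^+ 2)%:E <= (moment_bound f t 0)%:E)%E.
Proof.
move=> cf f00 bf t0; set I := (X in (X <= _)%E).
have fI : I \is a fin_num.
  rewrite ge0_fin_numE; last by apply: integral_ge0 => w _; rewrite lee_fin sqr_ge0.
  have e0 : 0 < 8^-1 :> R by [].
  exact: le_lt_trans (second_moment_scaled cf f00 bf e0 (lexx _) t0) (ltry _).
rewrite -(fineK fI) lee_fin.
set M := fine (mu `[0, t]%classic).
apply: (@ler_add_div_nat _ _ _ (expR M * (8^-1 * (8 * M ^+ 2 + 20 * M)))) => N.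
have N1 : 0 < N.+1%:R^-1 :> R by rewrite invr_gt0.
have N2 : N.+1%:R^-1 <= 1 :> R by rewrite invf_le1// ler1n.
have e0 : 0 < 8^-1 * N.+1%:R^-1 :> R by rewrite mulr_gt0.
have e8 : 8^-1 * N.+1%:R^-1 <= 8^-1 :> R by rewrite ler_piMr.
have := second_moment_scaled cf f00 bf e0 e8 t0.
rewrite -/I -(fineK fI) lee_fin /moment_bound /= -/M; set v := N.+1%:R^-1.
rewrite (mul0r (8 * M ^+ 2 + 20 * M)) addr0 => Ile; apply: (le_trans Ile).
set A := _ + conv_fun _ _ _; set B := 8 * _ + _; clearbody A B v.
by have -> : expR M * (A + 8^-1 * v * B) =
  expR M * A + expR M * (8^-1 * B) * v by ring.
Qed.

End FellerSecondMoment.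

(** * Short intervals and windows *)

Section SmallIntervals.
Context {R : realType}.

Lemma itv_dist_le (x y a l : R) :
  a <= x <= a + l -> a <= y <= a + l -> `|x - y| <= l.
Proof. by move=> ? ?; rewrite ler_norml; lra. Qed.

(** An interval of length [l] squares into the band of width [l] around the
    diagonal, and [m x m] does not charge the diagonal. *)
Lemma small_intervals (m : probability (mR R) R) (eta : R) :
  (forall x, m [set x] = 0%E) -> 0 < eta ->
  exists n : nat, forall a : R,
    fine (m `[a, a + 3 / n.+1%:R]%classic) <= eta.
Proof.
move=> m0 eta0; apply: contrapT => /forallNP nex.
(* closed bands shrinking to the diagonal *)
pose D n : set (mR R * mR R) := [set p | `|p.1 - p.2| <= 3 / n.+1%:R].
have mB : measurable_fun [set: mR R * mR R] (fun p => `|p.1 - p.2| : mR R).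
  apply: measurableT_comp => //.
  by apply: measurable_funB; [exact: measurable_fst|exact: measurable_snd].
have mD n : measurable (D n).
  rewrite (_ : D n = setT `&` (fun p : mR R * mR R => `|p.1 - p.2| : mR R)
    @^-1` `]-oo, 3 / n.+1%:R]%classic); first exact: mB.
  by rewrite setTI; apply/seteqP; split=> p /=; rewrite in_itv.
have mcap : measurable (\bigcap_n D n) by exact: bigcapT_measurable.
have cap0 : ((m \x m) (\bigcap_n D n) = 0)%E.
  rewrite /product_measure1 integral0_eq// => x _ /=.
  rewrite (_ : xsection _ x = [set x])//.
  apply/seteqP; split=> y; rewrite /xsection /= inE; last first.
    by move=> -> n _; rewrite /D /= subrr normr0.
  move=> capD; apply/eqP; rewrite -subr_eq0 -normr_le0 distrC.
  apply: (@ler_add_div_nat _ _ _ 3) => n; rewrite add0r.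
  exact: (capD n I).
have big n : ((eta ^+ 2)%:E <= (m \x m) (D n))%E.
  have /existsNP[a /negP] := nex n; rewrite -ltNge => lta.
  set I := `[a, a + 3 / n.+1%:R]%classic in lta.
  have mI : measurable (I : set (mR R)) by exact: measurable_itv.
  apply: (@le_trans _ _ ((m \x m) ((I : set (mR R)) `*` (I : set (mR R))))%E).
    have fI : m I \is a fin_num by exact: fin_num_measure.
    rewrite [leRHS](_ : _ = (m I * m I)%E); last exact: product_measure1E.
    rewrite -(fineK fI).
    rewrite -EFinM lee_fin -expr2 lerXn2r ?nnegrE ?fine_ge0//; exact: ltW.
  apply: (@le_measure _ _ _ (m \x m)%E); rewrite ?inE//.
    exact: measurableX.
  move=> [x y] /= []; rewrite /I /= !in_itv /=; exact: itv_dist_le.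
have cv : (m \x m)%E (D n) @[n --> \oo] --> (m \x m)%E (\bigcap_n D n).
  apply: (@nonincreasing_cvg_mu _ _ _ (m \x m)%E) => //.
    rewrite (le_lt_trans (probability_le1 (m \x m)%E (mD 0%N)))//.
    exact: ltry.
  move=> i j ij; apply/subsetPset => p; rewrite /D /= => /le_trans; apply.
  by rewrite ler_pM2l// lef_pV2 ?posrE// ler_nat.
have : ((eta ^+ 2)%:E <= limn (fun n => (m \x m) (D n)))%E.
  by apply: lime_ge; [exact: cvgP cv|exact: nearW].
by rewrite (cvg_lim _ cv)// cap0 leNgt lte_fin exprn_gt0.
Qed.

End SmallIntervals.

Section Windows.
Context {R : realType}.

Definition clamp (x : R) : R := Num.min 1 (Num.max 0 x).

Lemma clamp01 x : 0 <= clamp x <= 1.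
Proof. by rewrite /clamp le_min ler01 le_max lexx/= ge_min lexx. Qed.

Lemma clamp_le0 x : x <= 0 -> clamp x = 0.
Proof. by move=> x0; rewrite /clamp (max_idPl x0) (min_idPr ler01). Qed.

Lemma clamp_ge1 x : 1 <= x -> clamp x = 1.
Proof.
move=> x1; rewrite /clamp (max_idPr (le_trans ler01 x1)).
exact/min_idPl.
Qed.

Lemma le_clamp x y : x <= y -> clamp x <= clamp y.
Proof.
move=> xy; rewrite /clamp le_min ge_min lexx /= ge_min; apply/orP; right.
by rewrite ge_max !le_max lexx xy orbT.
Qed.

Lemma continuous_clamp : continuous clamp.
Proof.
move=> x; apply: (@continuous_min R R (fun=> 1)); first exact: cst_continuous.
apply: (@continuous_max R R (fun=> 0)); first exact: cst_continuous.
exact: cvg_id.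
Qed.

(** A trapezoidal window: 1 on [k+1, k+2] and 0 outside [k, k+3], on the scale
    [1/n]. *)
Definition window (n k : nat) (u : R) : R :=
  clamp (n%:R * u - k%:R) - clamp (n%:R * u - k%:R - 2).

Lemma continuous_window n k : continuous (window n k).
Proof.
have lin c : continuous (fun u : R => n%:R * u - c).
  by move=> x; apply: cvgB; [apply: cvgMr; exact: cvg_id|exact: cvg_cst].
move=> x; apply: cvgB.
  exact: (continuous_comp (lin _ x) (@continuous_clamp _)).
rewrite (_ : (fun u => _) = clamp \o (fun u : R => n%:R * u - (k%:R + 2))).
  rewrite (_ : _ - 2 = n%:R * x - (k%:R + 2)); last by ring.
  exact: (continuous_comp (lin _ x) (@continuous_clamp _)).
by apply/funext => u /=; congr clamp; ring.
Qed.

Lemma window0 n k : window n k 0 = 0.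
Proof.
rewrite /window mulr0 sub0r !clamp_le0 ?subr0 ?oppr_le0//.
Qed.

Lemma bounded_window n k : bounded_mfun 1 (window n k).
Proof.
split.
  apply: (@continuous_measurable_fun R (window n k)).
  exact: continuous_window.
move=> u; have /andP[? ?] := clamp01 (n%:R * u - k%:R).
have /andP[? ?] := clamp01 (n%:R * u - k%:R - 2).
have : clamp (n%:R * u - k%:R - 2) <= clamp (n%:R * u - k%:R).
  by apply: le_clamp; lra.
by rewrite /window => ?; apply/andP; split; lra.
Qed.

Lemma window_eq1 n k (u : R) :
  k%:R + 1 <= n%:R * u <= k%:R + 2 -> window n k u = 1.
Proof.
move=> /andP[? ?]; rewrite /window clamp_ge1 ?clamp_le0 ?subr0//; lra.
Qed.

Lemma window_eq0 n k (u : R) :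
  ~~ (k%:R <= n%:R * u <= k%:R + 3) -> window n k u = 0.
Proof.
rewrite negb_and -!ltNge => /orP[?|?].
  by rewrite /window !clamp_le0 ?subr0//; lra.
by rewrite /window !clamp_ge1 ?subrr//; lra.
Qed.

Lemma sum_window_le2 n N (u : R) : \sum_(k < N) window n k u <= 2.
Proof.
pose r j := clamp (n%:R * u - j%:R).
(* telescoping with step 2 *)
have -> : \sum_(k < N) window n k u = r 0%N + r 1%N - (r N + r N.+1).
  elim: N => [|N IHN]; first by rewrite big_ord0 subrr.
  rewrite big_ord_recr /= IHN /window -/(r N).
  rewrite (_ : clamp (n%:R * u - N%:R - 2) = r N.+2); first by ring.
  by rewrite /r -[N.+2]addn2 natrD; congr clamp; ring.
have c01 j : 0 <= r j <= 1 by exact: clamp01.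
by case/andP: (c01 0%N); case/andP: (c01 1%N); case/andP: (c01 N);
  case/andP: (c01 N.+1); lra.
Qed.

Lemma window_cover n N (u : R) : (0 < n)%N -> 1 <= u -> n%:R * u < N.+1%:R ->
  exists2 k, (k < N)%N & window n k u = 1.
Proof.
move=> n0 u1 uN; set x := n%:R * u in uN.
have n1 : 1 <= n%:R :> R by rewrite ler1n.
have x1 : 1 <= x by rewrite -[leLHS]mul1r ler_pM.
have /andP[tx xt] := truncn_itv (le_trans ler01 x1).
have t0 : (0 < Num.truncn x)%N.
  by rewrite -ltnS -(ltr_nat R) (le_lt_trans x1).
exists (Num.truncn x).-1.
  by rewrite -ltnS prednK// -(ltr_nat R) (le_lt_trans tx).
apply: window_eq1; rewrite -/x -natr1.
by move: tx xt; rewrite -{1 2}(prednK t0) -!natr1; lra.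
Qed.

(** For each [tau] the integrand is supported in one interval of length [3/n]. *)
Lemma conv_window_le (m : probability (mR R) R) (n k : nat) (eta tau : R) :
  (0 < n)%N ->
  (forall a : R, fine (m `[a, a + 3 / n%:R]%classic) <= eta) ->
  conv_fun (window n k) m tau <= eta.
Proof.
move=> n0 small; set a := tau - (k%:R + 3) / n%:R.
have n0' : 0 < n%:R :> R by rewrite ltr0n.
pose J := `[a, a + 3 / n%:R]%classic : set (mR R).
apply: (@le_trans _ _ (\int[m]_(s in `[0, tau]) (\1_J s : R))).
  apply: le_Rintegral => //.
  - apply: conv_integrable (bounded_window n k).
    exact: probability_locally_finite.
  - apply: (@bounded_integrable _ _ _ _ 1) => //.
    + exact/locally_finite_itv/probability_locally_finite.
    + by apply: measurable_indic; exact: measurable_itv.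
    + by move=> x _; rewrite indicE; case: (_ \in _); rewrite /= ?normr1 ?normr0.
  - move=> s _; rewrite indicE mem_setE in_itv /=.
    have [_ /(_ (tau - s))/andP[_ w1]] := bounded_window n k.
    have [//|notin] := boolP (a <= s <= a + 3 / n%:R).
    rewrite window_eq0//; apply: contra notin => /andP[lo hi].
    have lo' : k%:R / n%:R <= tau - s by rewrite ler_pdivrMr// mulrC.
    have hi' : tau - s <= (k%:R + 3) / n%:R by rewrite ler_pdivlMr// mulrC.
    by move: lo' hi'; rewrite /a mulrDl => *; apply/andP; split; lra.
have mJ : measurable J by exact: measurable_itv.
have mJt : measurable (J `&` `[0, tau]%classic) by exact: measurableI.
rewrite /Rintegral integral_indic//.
apply: le_trans (small a); rewrite fine_le ?fin_num_measure//.
by apply: le_measure; rewrite ?inE.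
Qed.

End Windows.

(** * Absence of atoms *)

Section AtomFree.
Context {R : realType}.
Variables (rho : probability (mR R) R) (mu : {measure set (mR R) -> \bar R}).
Hypothesis mu_fin : locally_finite mu.

Definition total_bound (t : R) : R :=
  let M := fine (mu `[0, t]%classic) in expR M * (2 * M ^+ 2 + 2 * M).

Lemma moment_bound0_le (f : R -> R) (eta t : R) : 0 <= eta ->
  bounded_mfun 1 f -> bounded_mfun eta (conv_fun f rho) ->
  moment_bound rho mu f t 0 <=
  expR (fine (mu `[0, t]%classic)) *
  (eta * (fine (mu `[0, t]%classic) * conv_fun (conv_fun f rho) mu t +
          conv_fun (conv_fun (conv_fun f rho) rho) mu t)).
Proof.
move=> eta0 bf; rewrite /moment_bound /=.
have : bounded_mfun 1 (conv_fun f rho) by exact: bounded_conv_fun.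
move: (conv_fun f rho) => g bg bge; set M := fine _.
have rho_fin := probability_locally_finite rho.
have bgg : bounded_mfun 1 (conv_fun g rho) by exact: bounded_conv_fun.
have bg2 : bounded_mfun 1 (fun x => g x ^+ 2).
  by have := bounded_mfunX 2 bg; rewrite expr1n.
have g_eta x : 0 <= g x /\ g x <= eta by case: bge => _ /(_ x)/andP.
have G0 : 0 <= conv_fun g mu t.
  by apply: conv_fun_ge0 => x; case: (g_eta x).
have Ge : conv_fun g mu t <= eta * M.
  rewrite -conv_fun_cst.
  apply: (le_conv_fun _ mu_fin bg (bounded_mfun_cst eta0)) => x.
  by case: (g_eta x).
have sq : conv_fun g mu t ^+ 2 <= eta * (M * conv_fun g mu t).
  by rewrite mulrA expr2 ler_wpM2r.
have Qe : conv_fun (conv_fun (fun x => g x ^+ 2) rho) mu t <=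
    eta * conv_fun (conv_fun g rho) mu t.
  rewrite -(conv_funZ _ _ mu_fin bgg).
  apply: (le_conv_fun _ mu_fin (bounded_conv_fun rho ler01 bg2)
    (bounded_mfunZ eta0 bgg)) => x.
  rewrite -(conv_funZ _ _ rho_fin bg).
  apply: (le_conv_fun _ rho_fin bg2 (bounded_mfunZ eta0 bg)) => y.
  by case: (g_eta y) => ? ?; rewrite expr2 ler_wpM2r.
rewrite (mul0r (8 * M ^+ 2 + 20 * M)) addr0.
apply: ler_wpM2l; first exact: expR_ge0.
rewrite [eta * (_ + _)]mulrDr; exact: lerD.
Qed.

(** Means and variances over the windows add up linearly once one factor of
    each square is bounded by [eta]. *)
Lemma sum_moment_bound_le (n N : nat) (eta t : R) : (0 < n)%N -> 0 <= eta ->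
  (forall a : R, fine (rho `[a, a + 3 / n%:R]%classic) <= eta) ->
  \sum_(k < N) moment_bound rho mu (window n k) t 0 <= eta * total_bound t.
Proof.
move=> n0 eta0 small; rewrite /total_bound /=.
set M := fine (mu `[0, t]%classic).
have rho_fin := probability_locally_finite rho.
have M0 : 0 <= M by exact: fine_ge0.
have bw := @bounded_window R n.
pose g k := conv_fun (window n k) rho.
pose gg k := conv_fun (g k) rho.
have bg k : bounded_mfun 1 (g k) by exact: bounded_conv_fun.
have bgg k : bounded_mfun 1 (gg k) by exact: bounded_conv_fun.
have bge k : bounded_mfun eta (g k).
  split; first by case: (bg k).
  move=> x; case: (bg k) => _ /(_ x)/andP[-> _] /=.
  exact: conv_window_le.
have bsum (F : nat -> R -> R) : (forall k, bounded_mfun 1 (F k)) ->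
    (forall x, \sum_(k < N) F k x <= 2) ->
    bounded_mfun 2 (fun x => \sum_(k < N) F k x).
  move=> bF F2; split.
    by apply: measurable_sum => k; case: (bF k).
  move=> x; rewrite F2 andbT; apply: sumr_ge0 => k _.
  by case: (bF k) => _ /(_ x)/andP[].
have conv2 (kappa : {measure set (mR R) -> \bar R}) (F : nat -> R -> R) x :
    locally_finite kappa -> (forall k, bounded_mfun 1 (F k)) ->
    (forall y, \sum_(k < N) F k y <= 2) ->
    \sum_(k < N) conv_fun (F k) kappa x <= 2 * fine (kappa `[0, x]%classic).
  move=> kfin bF F2; rewrite -(conv_fun_sum _ _ kfin bF) -conv_fun_cst.
  by apply: (le_conv_fun _ kfin (bsum F bF F2) (bounded_mfun_cst _)).
have g2 x : \sum_(k < N) g k x <= 2.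
  apply: (le_trans (conv2 _ _ _ rho_fin bw (sum_window_le2 n N))).
  by case/andP: (prob_itv_le1 rho x) => _; lra.
have gg2 x : \sum_(k < N) gg k x <= 2.
  apply: (le_trans (conv2 _ _ _ rho_fin bg g2)).
  by case/andP: (prob_itv_le1 rho x) => _; lra.
have term k : moment_bound rho mu (window n k) t 0 <=
    expR M * (eta * (M * conv_fun (g k) mu t + conv_fun (gg k) mu t)).
  exact: moment_bound0_le (bw k) (bge k).
apply: (@le_trans _ _ (\sum_(k < N)
    expR M * (eta * (M * conv_fun (g k) mu t + conv_fun (gg k) mu t)))).
  by apply: ler_sum => k _; exact: term.
rewrite -mulr_sumr mulrCA ler_wpM2l ?expR_ge0// -mulr_sumr ler_wpM2l//.
rewrite big_split /= -mulr_sumr lerD//.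
  rewrite expr2 mulrCA ler_wpM2l//; exact: conv2.
exact: conv2.
Qed.

Variables (d : measure_display) (Omega : measurableType d).
Variables (P : probability Omega R) (xi : R.-ker Omega ~> measurableTypeR R).
Hypothesis xi_Feller : Feller_random_measure P mu rho xi.
Hypothesis rho_atomless : forall x, rho [set x] = 0%E.

Let xi_fin w : locally_finite (xi w).
Proof. by case: xi_Feller => /(_ w)[]. Qed.

(** An atom inside a window is seen by the window in full. *)
Lemma atom_le_conv_window (kappa : {measure set (mR R) -> \bar R})
    (n k : nat) (t s : R) :
  locally_finite kappa -> 0 <= s <= t -> window n k (t - s) = 1 ->
  fine (kappa [set s]) <= conv_fun (window n k) kappa t.
Proof.
move=> kfin /andP[s0 st] w1.
have kt := locally_finite_itv t kfin.
have -> : fine (kappa [set s]) = \int[kappa]_(x in `[0, t]) (\1_[set s] x : R).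
  rewrite /Rintegral integral_indic//; congr (fine (kappa _)).
  by apply/seteqP; split=> [x /= ->|x []//]; rewrite in_itv /= s0 st.
apply: le_Rintegral => //.
- apply: (@bounded_integrable _ _ _ _ 1) => //.
  by move=> x _; rewrite indicE; case: (_ \in _); rewrite /= ?normr1 ?normr0.
- exact: conv_integrable kfin (bounded_window n k).
- move=> x _; rewrite indicE; case: (boolP (x \in _)).
    by rewrite in_setE /= => ->; rewrite w1.
  by move=> _; case: (@bounded_window R n k) => _ /(_ (t - x))/andP[].
Qed.

Lemma large_atoms_le (T : nat) (c eta : R) : 0 < c -> 0 < eta ->
  exists2 A, measurable A &
    [set w | exists2 s, 0 <= s <= T%:R & c <= fine (xi w [set s])] `<=` A /\
    (P A <= (eta / c ^+ 2 * total_bound T.+1%:R)%:E)%E.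
Proof.
move=> c0 eta0; have [n small] := small_intervals rho_atomless eta0.
(* at time [T + 1] every [s <= T] is at distance at least 1 from [t], hence
   covered by a window although test functions vanish at 0 *)
pose t : R := T.+1%:R; pose N := (n.+1 * T.+1)%N.
pose X k w := conv_fun (window n.+1 k) (xi w) t.
pose Y w := \sum_(k < N) X k w ^+ 2.
have mX k : measurable_fun setT (X k).
  exact: kernel_measurable_conv_fun (bounded_window n.+1 k).
have mX2 k : measurable_fun setT (fun w => X k w ^+ 2).
  exact: measurable_funX.
have mY : measurable_fun setT Y by exact: measurable_sum.
have EY : (\int[P]_w (Y w)%:E <=
    (eta * total_bound t)%:E)%E.
  under eq_integral do rewrite /Y -sumEFin.
  rewrite ge0_integral_sum//; last 2 first.
  - by move=> k; exact/measurable_EFinP.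
  - by move=> k w _; rewrite lee_fin sqr_ge0.
  apply: (@le_trans _ _ (\sum_(k < N)
      (moment_bound rho mu (window n.+1 k) t 0)%:E)%E).
    apply: lee_sum => k _; apply: second_moment_le => //.
    - exact: continuous_window.
    - exact: window0.
    - exact: bounded_window.
  by rewrite sumEFin lee_fin; apply: sum_moment_bound_le => //; exact: ltW.
exists (setT `&` [set w | ((c ^+ 2)%:E <= `|(Y w)%:E|)%E]).
  by apply: emeasurable_fun_c_infty => //; apply: measurableT_comp => //;
    exact/measurable_EFinP.
have Y0 w : 0 <= Y w by apply: sumr_ge0 => k _; exact: sqr_ge0.
split.
  move=> w [s /andP[s0 sT] cs]; split => //=.
  rewrite lee_fin ger0_norm//.
  have st : 0 <= s <= t by rewrite s0/= (le_trans sT)// ler_nat.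
  have [k kN wk] : exists2 k, (k < N)%N & window n.+1 k (t - s) = 1.
    apply: window_cover => //.
      by rewrite lerBrDr /t -natr1 addrC lerD2r.
    rewrite /N -[X in _ < X]natr1 natrM -/t.
    apply: (@le_lt_trans _ _ (n.+1%:R * t)); last by rewrite ltrDl.
    by rewrite ler_pM2l// gerBl.
  have := atom_le_conv_window (xi_fin w) st wk; rewrite -/(X k w) => le_X.
  apply: (@le_trans _ _ (X k w ^+ 2)).
    rewrite lerXn2r ?nnegrE ?(ltW c0)//; last exact: le_trans le_X.
    exact: le_trans (ltW c0) (le_trans cs le_X).
  rewrite /Y (bigD1 (Ordinal kN))//= lerDl; apply: sumr_ge0 => j _.
  exact: sqr_ge0.
rewrite -(@lee_pmul2l _ (c ^+ 2)%:E) ?lte_fin ?exprn_gt0//.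
apply: (@le_trans _ _ (\int[P]_w `|(Y w)%:E|)%E).
  by apply: le_integral_abse; rewrite ?exprn_gt0//; exact/measurable_EFinP.
rewrite (_ : (\int[P]_w `|(Y w)%:E| = \int[P]_w (Y w)%:E)%E); last first.
  by apply: eq_integral => w _; rewrite gee0_abs// lee_fin.
apply: (le_trans EY); rewrite -EFinM lee_fin -/t.
rewrite (_ : c ^+ 2 * _ = eta * total_bound t)//.
by field; rewrite gt_eqF.
Qed.

(** The bound of [large_atoms_le] for [eta] tending to 0. *)
Lemma large_atoms_negligible (T : nat) (c : R) : 0 < c ->
  P.-negligible
    [set w | exists2 s, 0 <= s <= T%:R & c <= fine (xi w [set s])].
Proof.
move=> c0; set B := [set w | _].
have Aex j : exists A, [/\ measurable A, B `<=` A &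
    (P A <= (j.+1%:R^-1 / c ^+ 2 * total_bound T.+1%:R)%:E)%E].
  have j0 : 0 < j.+1%:R^-1 :> R by rewrite invr_gt0.
  by have [A mA [BA PA]] := large_atoms_le T c0 j0; exists A.
have [A AP] := choice Aex.
exists (\bigcap_j A j); split.
- by apply: bigcapT_measurable => j; case: (AP j).
- apply/eqP; rewrite eq_le measure_ge0 andbT.
  have mcap : measurable (\bigcap_j A j).
    by apply: bigcapT_measurable => j; case: (AP j).
  have fcap : P (\bigcap_j A j) \is a fin_num by exact: fin_num_measure.
  rewrite -(fineK fcap) lee_fin.
  apply: (@ler_add_div_nat _ _ _ (total_bound T.+1%:R / c ^+ 2)) => j.
  rewrite add0r -lee_fin fineK//.
  have [mA _ PA] := AP j; apply: (@le_trans _ _ (P (A j))).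
    by apply: le_measure; rewrite ?inE// => w /(_ j I).
  apply: (le_trans PA); rewrite lee_fin le_eqVlt; apply/orP; left; apply/eqP.
  move: (total_bound _) (j.+1%:R^-1) (c ^+ 2) => x y z.
  by rewrite mulrAC -mulrA mulrC.
- by move=> w Bw j _; case: (AP j) => _ /(_ w Bw).
Qed.

End AtomFree.

Unset Implicit Arguments.

Theorem proposition3p14 (R : realType)
    (rho : probability (measurableTypeR R) R)
    (rho_GID : GID rho)
    (rho0 : rho [set 0] = 0%E)
    (mu : {measure set (measurableTypeR R) -> \bar R})
    (mu_half_line : on_half_line mu)
    (mu_locally_finite : locally_finite mu)
    (d : measure_display) (Omega : measurableType d) (P : probability Omega R)
    (xi : R.-ker Omega ~> measurableTypeR R)
    (xi_Feller : Feller_random_measure P mu rho xi) :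
  {ae P, forall w : Omega, forall t : R, 0 <= t -> xi w [set t] = 0%E}.
Proof.
have rho_atomless x := GID_atomless x rho_GID rho0.
have negl := large_atoms_negligible mu_locally_finite xi_Feller rho_atomless.
have cover := negligible_bigcup (fun T => negligible_bigcup (fun j =>
  negl T j.+1%:R^-1 ltac:(by rewrite invr_gt0))).
apply: negligibleS cover => w /= /existsNP[t /not_implyP[t0 atom]].
have [_ xi_fin] := proj1 xi_Feller w.
have fin_t : xi w [set t] \is a fin_num.
  rewrite ge0_fin_numE//; apply: xi_fin => //.
  by exists `|t|; split; [exact: num_real|move=> M tM _ ->; exact: ltW].
have : 0 < fine (xi w [set t]).
  by rewrite fine_gt0// lt0e measure_ge0 andbT -ge0_fin_numE// fin_t andbT;
    exact/eqP.
move=> /ltr_add_invr[j]; rewrite add0r => jt.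
exists (Num.bound t) => //; exists j => //; exists t; last exact: ltW.
by rewrite t0 ltW// archi_boundP.
Qed.
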